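(* Let $H$ be a separable infinite-dimensional Hilbert space. There is a normalized frame $(f_{i})_{i=1}^{\infty}$ for $H$ (that is, a frame with $\|f_i\|=1$ for all $i$) which contains a subset that is a Schauder basis for $H$, but which does not contain any subset that is a Riesz basis for $H$ (and hence does not contain any subset which is an unconditional basis for $H$).
   Context: A family $(f_{i})_{i\in I}$ in a Hilbert space $H$ is a frame for $H$ if there are constants $0<A\le B<\infty$ with $A\|f\|^{2}\le \sum_{i\in I}|\langle f,f_{i}\rangle|^{2}\le B\|f\|^{2}$ for all $f\in H$. A sequence $(f_{i})_{i=1}^{\infty}$ is a Schauder basis for $H$ if for every $f\in H$ there is a unique sequence of scalars $(a_{i})_{i=1}^{\infty}$ such that $f=\sum_{i=1}^{\infty}a_{i}f_{i}$ (convergence in norm). A family $(f_{i})_{i\in I}$ is a Riesz basis for $H$ if its closed linear span is $H$ and there is a constant $M$ with $\frac{1}{M}\left(\sum_{i\in I}|a_{i}|^{2}\right)^{1/2}\le \left\|\sum_{i\in I}a_{i}f_{i}\right\|\le M\left(\sum_{i\in I}|a_{i}|^{2}\right)^{1/2}$ for every finitely supported choice of scalars $(a_{i})_{i\in I}$. *)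

(* Defs.v *)
From HB Require Import structures.
From mathcomp Require Import all_boot all_order all_algebra.
From mathcomp Require Import finmap.
From mathcomp Require Import all_classical all_reals all_analysis.
From mathcomp Require Import complex.

Set Implicit Arguments.
Unset Strict Implicit.
Unset Printing Implicit Defensive.

Import Order.TTheory GRing.Theory Num.Theory.
Import numFieldNormedType.Exports.

Local Open Scope classical_set_scope.
Local Open Scope ring_scope.

(* A Hilbert space may be real or complex; [theta] is the involution for which
   its inner product is sesquilinear. *)
Inductive hilbert_scalars (R : realType) :
    forall K : numFieldType, (K -> K) -> Prop :=
| real_scalars : @hilbert_scalars R R idfun
| complex_scalars : @hilbert_scalars R R[i] Num.conj.

(* Norms take their values in K, as for any [normedModType K]; a Hilbert space
   is a [completeNormedModType K] whose norm comes from an inner product. *)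
Definition norm_from_dot (K : numFieldType) (theta : K -> K)
    (H : normedModType K) (ip : {dot H for theta}) : Prop :=
  forall x : H, `|x| ^+ 2 = ip x x.

Definition separable (T : topologicalType) : Prop :=
  exists2 D : set T, countable D & dense D.

Definition finite_dimensional (K : numFieldType) (V : lmodType K) : Prop :=
  exists (n : nat) (v : 'I_n -> V),
    forall x : V, exists a : 'I_n -> K, x = \sum_(i < n) a i *: v i.

(* The nonnegative square root in K (0 if there is none): a generic
   numFieldType has no square root function of its own, see
   [nnsqrt_real] and [nnsqrt_complex]. *)
Definition nnsqrt (K : numFieldType) (x : K) : K :=
  xget 0 [set s : K | 0 <= s /\ s ^+ 2 = x].

Lemma nnsqrtE (K : numFieldType) (x s : K) :
  0 <= s -> s ^+ 2 = x -> nnsqrt x = s.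
Proof.
move=> s0 sx; apply: xget_unique => //= t [t0 tx].
by apply/eqP; rewrite -(@eqrXn2 _ 2) // tx sx.
Qed.

Lemma nnsqrt_real (R : realType) (x : R) : 0 <= x -> nnsqrt x = Num.sqrt x.
Proof. by move=> x0; apply: nnsqrtE; rewrite ?sqrtr_ge0 ?sqr_sqrtr. Qed.

Lemma nnsqrt_complex (R : realType) (x : R[i]) : 0 <= x -> nnsqrt x = sqrtC x.
Proof. by move=> x0; apply: nnsqrtE; rewrite ?sqrtC_ge0 ?sqrtCK. Qed.

Definition is_frame (K : numFieldType) (theta : K -> K)
    (H : normedModType K) (ip : {dot H for theta}) (f : nat -> H) : Prop :=
  exists A B : K, [/\ 0 < A, A <= B &
    forall x : H, let S := series (fun i => `|ip x (f i)| ^+ 2 : K) in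
      cvgn S /\ A * `|x| ^+ 2 <= limn S <= B * `|x| ^+ 2].

Definition schauder_basis (K : numFieldType) (H : normedModType K)
    (e : nat -> H) : Prop :=
  forall x : H, exists! a : nat -> K,
    series (fun n => a n *: e n) @ \oo --> x.

(* The sum of a series all of whose rearrangements converge does not depend on
   the rearrangement, so convergence alone is required here. *)
Definition unconditional_basis (K : numFieldType) (H : normedModType K)
    (e : nat -> H) : Prop :=
  schauder_basis e /\
  forall a : nat -> K, cvgn (series (fun n => a n *: e n)) ->
    forall p : nat -> nat, bijective p ->
      cvgn (series (fun n => a (p n) *: e (p n))).

Definition linear_span (K : numFieldType) (V : lmodType K) (I : choiceType)
    (J : set I) (f : I -> V) : set V :=
  [set x | exists (A : {fset I}) (a : I -> K),
     [set` A] `<=` J /\ x = \sum_(i <- A) a i *: f i].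

(* The subfamily (f i)_{i in J} is a Riesz basis; a finitely supported choice
   of scalars is given by its values on a finite set A of indices. *)
Definition riesz_basis (K : numFieldType) (H : normedModType K)
    (I : choiceType) (J : set I) (f : I -> H) : Prop :=
  closure (linear_span J f) = setT /\
  exists2 M : K, 0 < M &
    forall (A : {fset I}) (a : I -> K), [set` A] `<=` J ->
      let l2 := nnsqrt (\sum_(i <- A) `|a i| ^+ 2) in
      M^-1 * l2 <= `|\sum_(i <- A) a i *: f i| <= M * l2.

(* Main.v *)
From HB Require Import structures.
Require Import Defs.
From mathcomp Require Import all_boot all_order all_algebra.
From mathcomp Require Import finmap.
From mathcomp Require Import all_classical all_reals all_analysis.
From mathcomp Require Import complex.
From mathcomp Require Import ring lra zify.
Import Order.TTheory GRing.Theory Num.Theory.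
Import numFieldNormedType.Exports.
Local Open Scope classical_set_scope.
Local Open Scope ring_scope.

Set Implicit Arguments.
Unset Strict Implicit.
Unset Printing Implicit Defensive.

(** The idea.  Cut [H] into orthogonal blocks: block [n] is spanned by [2 ^ N]
    vectors [e_i] of an orthonormal basis, with [N = 5 n + 1].  Let [E_s] be
    averaging over the dyadic intervals of length [2 ^ s], and put on the block
    [T = \sum_(0 < s <= N) tau_s (E_(s-1) - E_s) + tau_N E_N], where [tau_s] is
    [1] for [s <= lam = n + 1] and then decreases by the factor [9 / 10] per
    scale.  The frame consists of the normalized vectors [T e_i] (the leaves)
    and the normalized indicators of the dyadic intervals of length [2 ^ lam]
    (the means).

    It is a frame because [T] is a contraction which is the identity on the
    orthogonal complement of the functions that are constant on the intervals of
    length [2 ^ lam], and the means form an orthonormal basis of those functions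
    ([dyadic_op_bessel], [frame_lower]).

    The leaves form a Schauder basis although [T ^-1] has norm [(10 / 9) ^ (4 n)]
    on block [n]: what matters is the size of [T P T ^-1], where [P] cuts
    a sequence at an index [m].  [P] commutes with averaging over every dyadic
    interval that does not contain [m].  Along the branch of intervals that
    contain [m], normalized Haar functions at two scales [s < s'] interact with
    weight [2 ^ (- (s' - s) / 2)], and the weights [tau] vary more slowly than
    this, so the interaction is summable with a bound independent of
    the block ([dyadic_op_truncate]).

    No subfamily is a Riesz basis.  Take a subfamily with dense span and look at
    block [n].  If all leaves [T e_i] are present, then
    [\sum_i T e_i = tau_N \sum_i e_i] is a combination of small norm.  If some
    [T e_i] is missing, approximate it by a combination of the others; since [T]
    changes functions only by constants on each interval of length [2 ^ lam], the
    coefficient of each other leaf in the interval of [i] has to be close to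
    [-1], up to normalization.  Either way a combination of vectors of block [n]
    has squared norm at most [64 / 2 ^ n] times the sum of the squared
    coefficients ([block_small_combination]).

    No subsequence is an unconditional basis.  Scale these combinations to
    coefficients with square sum [4]; their sums [y_n] are orthogonal and
    summable.  The expansion of [\sum_n y_n] must have on each block the
    coefficients of [y_n], so a choice of signs gives in every block finitely
    many terms whose sum has norm at least [1].  A rearrangement that makes these
    terms consecutive diverges ([divergent_rearrangement]).

    Real and complex scalars are treated together through their real and
    imaginary parts: [T] has real coefficients, so it acts on each part. *)

(** * The dyadic multiplier *)

Section DyadicOperator.
Variables (F : numFieldType) (V : lmodType F).
Implicit Types (tau : nat -> F) (v w : nat -> V) (n i : nat).

Definition upper_half (A : Type) n (v : nat -> A) : nat -> A :=
  fun i => v (2 ^ n + i)%N.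

Definition jump tau n : F := (tau n - tau n.+1) / 2 ^+ n.

(** On the indices below [2 ^ n] this is the multiplier
    [1 - \sum_(s < n) (tau s - tau s.+1) E_s], where [E_s] is averaging over the
    dyadic intervals of length [2 ^ s].  When [tau 0 = 1] it multiplies the Haar
    functions supported on intervals of length [2 ^ s] by [tau s], and the
    constants by [tau n].  The recursion splits [0, 2 ^ n.+1[ into its two
    halves, on which everything is proved by induction.  The values may be
    scalars (coordinates) or vectors: applied to an orthonormal family it yields
    the images of the basis vectors under the multiplier. *)
Fixpoint dyadic_op tau n v : nat -> V :=
  if n is p.+1 then fun i =>
    if (i < 2 ^ p)%N
    then dyadic_op tau p v i - jump tau p *: \sum_(j < 2 ^ p) v j
    else dyadic_op tau p (upper_half p v) (i - 2 ^ p)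
         - jump tau p *: \sum_(j < 2 ^ p) upper_half p v j
  else v.

Lemma sum_halves (W : nmodType) n (g : nat -> W) :
  \sum_(i < 2 ^ n.+1) g i
  = \sum_(i < 2 ^ n) g i + \sum_(i < 2 ^ n) upper_half n g i.
Proof.
rewrite expnS mul2n -addnn big_split_ord /=; congr (_ + _).
Qed.

Lemma lt_halves n (P : nat -> Prop) :
  (forall i, (i < 2 ^ n)%N -> P i) -> (forall i, (i < 2 ^ n)%N -> P (2 ^ n + i)%N) ->
  forall i, (i < 2 ^ n.+1)%N -> P i.
Proof.
move=> lo hi i; case: (ltnP i (2 ^ n)) => [/lo //|le_i lt_i].
rewrite -(subnKC le_i); apply: hi; rewrite expnS in lt_i; lia.
Qed.

Lemma dyadic_op_lo tau n v i : (i < 2 ^ n)%N ->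
  dyadic_op tau n.+1 v i = dyadic_op tau n v i - jump tau n *: \sum_(j < 2 ^ n) v j.
Proof. by move=> /= ->. Qed.

Lemma dyadic_op_hi tau n v i :
  dyadic_op tau n.+1 v (2 ^ n + i)%N = dyadic_op tau n (upper_half n v) i
     - jump tau n *: \sum_(j < 2 ^ n) upper_half n v j.
Proof. by rewrite /= ltnNge leq_addr /= addKn. Qed.

Lemma eq_dyadic_op tau n v w : (forall i, (i < 2 ^ n)%N -> v i = w i) ->
  forall i, (i < 2 ^ n)%N -> dyadic_op tau n v i = dyadic_op tau n w i.
Proof.
elim: n v w => [v w vw i /vw //|n IH v w vw].
have lo j : (j < 2 ^ n)%N -> v j = w j by move=> lt; apply: vw; rewrite expnS; lia.
have hi j : (j < 2 ^ n)%N -> upper_half n v j = upper_half n w j.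
  by move=> lt; apply: vw; rewrite expnS; lia.
apply: lt_halves => i lt_i.
  rewrite !dyadic_op_lo // (IH _ _ lo) //; congr (_ - _ *: _).
  by apply: eq_bigr => j _; apply: lo.
rewrite !dyadic_op_hi (IH _ _ hi) //; congr (_ - _ *: _).
by apply: eq_bigr => j _; apply: hi.
Qed.

Lemma dyadic_op_cst tau n (x : V) i : tau 0%N = 1 -> (i < 2 ^ n)%N ->
  dyadic_op tau n (fun=> x) i = tau n *: x.
Proof.
move=> tau0; elim: n i => [|n IH] i; first by rewrite /= tau0 scale1r.
have E : tau n *: x - jump tau n *: \sum_(j < 2 ^ n) x = tau n.+1 *: x.
  rewrite sumr_const card_ord -scaler_nat scalerA -scalerBl natrX /jump; congr (_ *: _).
  by field; rewrite expf_neq0 ?pnatr_eq0.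
move: i; apply: lt_halves => i lt_i.
  by rewrite dyadic_op_lo // IH.
by rewrite dyadic_op_hi IH.
Qed.

Lemma dyadic_opB tau n v w i :
  dyadic_op tau n (fun j => v j - w j) i = dyadic_op tau n v i - dyadic_op tau n w i.
Proof.
elim: n v w i => [//|n IH] v w i /=.
by case: ifP => _; rewrite IH /upper_half sumrB scalerBr !opprD !addrA; congr (_ + _);
   rewrite -!addrA; congr (_ + _); rewrite addrC.
Qed.

Lemma sum_dyadic_op tau n v : tau 0%N = 1 ->
  \sum_(i < 2 ^ n) dyadic_op tau n v i = tau n *: \sum_(i < 2 ^ n) v i.
Proof.
move=> tau0; elim: n v => [|n IH] v.
  by rewrite !big_ord1 /= tau0 scale1r.
have E x : \sum_(i < 2 ^ n) (jump tau n *: x : V) = (tau n - tau n.+1) *: x.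
  rewrite sumr_const card_ord -scaler_nat scalerA natrX /jump; congr (_ *: _).
  by field; rewrite expf_neq0 ?pnatr_eq0.
rewrite sum_halves.
under eq_bigr do rewrite dyadic_op_lo //.
under [X in _ + X]eq_bigr do rewrite /upper_half dyadic_op_hi.
rewrite !sumrB !IH !E sum_halves scalerDr -!scalerBl.
by rewrite !opprB !(addrCA _ (tau n.+1)) subrr addr0.
Qed.

(** The multipliers commute and are diagonal in the Haar basis, so inverting
    the weights inverts the multiplier.  In the induction only the averages over
    the two halves are added, and there the claim reduces to
    [tau n * tau' n = tau n.+1 * tau' n.+1]. *)
Lemma dyadic_op_inv tau tau' n v i : (forall s, tau s * tau' s = 1) ->
  tau 0%N = 1 -> (i < 2 ^ n)%N ->
  dyadic_op tau n (dyadic_op tau' n v) i = v i.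
Proof.
move=> tauV tau0; have tau'0 : tau' 0%N = 1 by rewrite -[RHS](tauV 0%N) tau0 mul1r.
elim: n v i => [//|n IH] v.
have step (z : nat -> V) i : (i < 2 ^ n)%N ->
   dyadic_op tau n (fun j => dyadic_op tau' n z j - jump tau' n *: \sum_(j < 2 ^ n) z j) i
   - jump tau n *: \sum_(j < 2 ^ n) (dyadic_op tau' n z j - jump tau' n *: \sum_(j < 2 ^ n) z j)
   = z i.
  move=> lt_i; rewrite dyadic_opB IH // dyadic_op_cst // sumrB sum_dyadic_op //.
  rewrite sumr_const card_ord -scaler_nat !scalerA -scalerBl scalerA.
  rewrite -addrA -opprD -scalerDl [X in X *: _](_ : _ = 0) ?scale0r ?subr0 //.
  have := tauV n; have := tauV n.+1; rewrite natrX /jump => e1 e2.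
  have P : (2 ^+ n : F) != 0 by rewrite expf_neq0 ?pnatr_eq0.
  apply/eqP; rewrite -(mulrI_eq0 _ (mulfI P)); apply/eqP.
  transitivity (tau n * tau' n - tau n.+1 * tau' n.+1); first by field.
  by rewrite e1 e2 subrr.
apply: lt_halves => i lt_i.
  rewrite dyadic_op_lo // -[RHS](step v i lt_i); congr (_ - _ *: _).
    apply: eq_dyadic_op => // j lt_j; exact: dyadic_op_lo.
  by apply: eq_bigr => j _; rewrite dyadic_op_lo.
rewrite dyadic_op_hi -[RHS](step (upper_half n v) i lt_i); congr (_ - _ *: _).
  apply: eq_dyadic_op => // j lt_j; exact: dyadic_op_hi.
by apply: eq_bigr => j _; rewrite -dyadic_op_hi.
Qed.

(** Where the weights are constant no average is subtracted, and the averages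
    at scales from [lam] on do not distinguish points of an interval of length
    [2 ^ lam]. *)
Lemma dyadic_op_diff tau lam n v i k :
  (forall s, (s < lam)%N -> jump tau s = 0) ->
  (i < 2 ^ n)%N -> (k < 2 ^ n)%N -> (i %/ 2 ^ lam = k %/ 2 ^ lam)%N ->
  dyadic_op tau n v i - dyadic_op tau n v k = v i - v k.
Proof.
move=> low; elim: n v i k => [//|n IH] v i k li lk eik.
case: (ltnP n lam) => [n_lam|lam_n].
  have id m z j : (m <= lam)%N -> dyadic_op tau m z j = z j.
    elim: m z j => [//|m IHm] z j lt_m /=; rewrite !(IHm _ _ (ltnW lt_m)) low // !scale0r !subr0.
    by case: ltnP => // le; rewrite /upper_half subnKC.
  by rewrite !id.
have half : (i < 2 ^ n)%N = (k < 2 ^ n)%N.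
  have E m : (m < 2 ^ n)%N = (m %/ 2 ^ lam < 2 ^ (n - lam))%N.
    by rewrite ltn_divLR ?expn_gt0 // -expnD subnK.
  by rewrite !E eik.
rewrite /=; case: ifP half => [lt_i /esym lt_k|ge_i /esym ge_k]; rewrite ?lt_k ?ge_k.
  by rewrite opprB addrA subrK IH.
rewrite opprB addrA subrK; have := IH (upper_half n v) (i - 2 ^ n)%N (k - 2 ^ n)%N.
have ge m : (m < 2 ^ n)%N = false -> (2 ^ n <= m)%N by case: ltnP.
rewrite /upper_half !subnKC ?ge // => -> //; try by move: li lk; rewrite expnS; lia.
have E m : (2 ^ n <= m)%N -> ((m - 2 ^ n) %/ 2 ^ lam = m %/ 2 ^ lam - 2 ^ (n - lam))%N.
  rewrite -[n in (2 ^ n)%N](subnK lam_n) expnD => le.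
  by rewrite -[in RHS](subnKC le) divnMDl ?expn_gt0 // addKn.
by rewrite !E ?ge // eik.
Qed.

End DyadicOperator.

(** Used for inner products with a fixed vector and for the real and imaginary
    parts of the scalars, which need not be linear over [F]. *)
Lemma dyadic_op_map (F F' : numFieldType) (V : lmodType F) (W : lmodType F')
    (g : {additive V -> W}) (tau : nat -> F) (tau' : nat -> F') :
  (forall s x, g (jump tau s *: x) = jump tau' s *: g x) ->
  forall n v i, g (dyadic_op tau n v i) = dyadic_op tau' n (g \o v) i.
Proof.
move=> gZ; elim=> [//|n IH] v i /=.
by case: ifP => _; rewrite raddfB gZ IH raddf_sum.
Qed.

(** The matrix of the multiplier is symmetric. *)
Lemma dyadic_op_sym (F : numFieldType) (V : lmodType F) (tau : nat -> F) n
    (a : nat -> F^o) (v : nat -> V) :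
  \sum_(i < 2 ^ n) a i *: dyadic_op tau n v i
  = \sum_(i < 2 ^ n) (dyadic_op tau n a i : F) *: v i.
Proof.
elim: n a v => [|n IH] a v; first by rewrite !big_ord1.
rewrite (sum_halves n (fun i => a i *: dyadic_op tau n.+1 v i)).
rewrite (sum_halves n (fun i => (dyadic_op tau n.+1 a i : F) *: v i)).
congr (_ + _).
  under eq_bigr do rewrite dyadic_op_lo // scalerBr.
  under [RHS]eq_bigr do rewrite dyadic_op_lo // scalerBl.
  rewrite !sumrB IH; congr (_ - _).
  rewrite -scaler_sumr -scaler_suml.
  by rewrite scalerA mulrC.
under eq_bigr do rewrite [upper_half _ _ _]/upper_half dyadic_op_hi // scalerBr.
under [RHS]eq_bigr do rewrite [upper_half _ _ _]/upper_half dyadic_op_hi // scalerBl.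
rewrite !sumrB (IH (upper_half n a) (upper_half n v)); congr (_ - _).
by rewrite -scaler_suml -scaler_sumr scalerA mulrC.
Qed.

(** * Estimates for real sequences *)

Section RealEstimates.
Variable R : realFieldType.
Implicit Types (a : nat -> R^o) (n m i : nat).

Definition half_sum n a : R := \sum_(i < 2 ^ n) a i.

Definition truncate m a : nat -> R^o := fun i => if (i < m)%N then a i else 0.

Lemma half_sumS n a : half_sum n.+1 a = half_sum n a + half_sum n (upper_half n a).
Proof. exact: sum_halves. Qed.

Lemma eq_half_sum n a c : (forall i, (i < 2 ^ n)%N -> a i = c i) ->
  half_sum n a = half_sum n c.
Proof. by move=> e; apply: eq_bigr => i _; apply: e. Qed.

Lemma half_sum0 n : half_sum n (fun=> 0) = 0.
Proof. exact: big1. Qed.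

Section Weights.
Variable tau : nat -> R^o.
Hypothesis tau0 : tau 0%N = 1.
Hypothesis tau_gt0 : forall s, 0 < tau s.
Hypothesis tau_dec : forall s, tau s.+1 <= tau s.
Hypothesis tau_slow : forall s, tau s ^+ 2 <= 5 / 4 * tau s.+1 ^+ 2.

(** The square norm of the multiplied sequence without the contribution of
    the constants: the sum over the dyadic intervals of [tau s ^ 2] times the
    squared Haar coefficient. *)
Fixpoint haar_form n a : R :=
  if n is p.+1 then
    haar_form p a + haar_form p (upper_half p a)
    + tau n ^+ 2 * (half_sum p a - half_sum p (upper_half p a)) ^+ 2 / 2 ^+ n
  else 0.

Lemma eq_haar_form n a c : (forall i, (i < 2 ^ n)%N -> a i = c i) ->
  haar_form n a = haar_form n c.
Proof.
elim: n a c => [//|n IH] a c ac.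
have lo i : (i < 2 ^ n)%N -> a i = c i by move=> lt; apply: ac; rewrite expnS; lia.
have hi i : (i < 2 ^ n)%N -> upper_half n a i = upper_half n c i.
  by move=> lt; apply: ac; rewrite expnS; lia.
by rewrite /= (IH _ _ lo) (IH _ _ hi) (eq_half_sum lo) (eq_half_sum hi).
Qed.

Lemma haar_form_ge0 n a : 0 <= haar_form n a.
Proof.
elim: n a => [//|n IH] a /=.
rewrite !addr_ge0 // divr_ge0 ?exprn_ge0 //.
by rewrite mulr_ge0 // sqr_ge0.
Qed.

Lemma haar_form0 n : haar_form n (fun=> 0) = 0.
Proof.
elim: n => [//|n IH] /=.
have -> : upper_half n (fun=> 0 : R^o) = (fun=> 0) by [].
by rewrite IH half_sum0 subrr expr0n mulr0 mul0r !addr0.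
Qed.

Lemma jump2 n : 2 ^+ n * jump tau n = tau n - tau n.+1.
Proof.
by rewrite /jump mulrC divfK // expf_neq0 // pnatr_eq0.
Qed.

Lemma dyadic_op_sqr n a : \sum_(i < 2 ^ n) (dyadic_op tau n a i) ^+ 2
  = haar_form n a + tau n ^+ 2 * half_sum n a ^+ 2 / 2 ^+ n.
Proof.
elim: n a => [|n IH] a.
  by rewrite /half_sum !big_ord1 /= tau0 add0r expr1n mul1r expr0 divr1.
have step (c : nat -> R^o) : \sum_(i < 2 ^ n) (dyadic_op tau n c i
       - jump tau n *: \sum_(j < 2 ^ n) c j) ^+ 2
   = haar_form n c + tau n.+1 ^+ 2 * half_sum n c ^+ 2 / 2 ^+ n.
  under eq_bigr do rewrite sqrrB.
  rewrite big_split sumrB /= IH sumr_const card_ord sumrMnl -mulr_suml sum_dyadic_op //.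
  rewrite -/(half_sum n c) /= /GRing.scale /=.
  rewrite -[in RHS](subKr (tau n) (tau n.+1)) -jump2 -[_ *+ (2 ^ n)%N]mulr_natr natrX.
  by field; rewrite expf_neq0 ?pnatr_eq0.
rewrite (sum_halves n (fun i => (dyadic_op tau n.+1 a i) ^+ 2)).
under eq_bigr do rewrite dyadic_op_lo //.
under [X in _ + X]eq_bigr do rewrite [upper_half _ _ _]/upper_half dyadic_op_hi.
rewrite (step a) (step (upper_half n a)) half_sumS [haar_form _.+1 _]/= (exprS 2 n).
by field; rewrite expf_neq0 ?pnatr_eq0.
Qed.

Lemma dyadic_op_bessel n a :
  \sum_(i < 2 ^ n) (dyadic_op tau n a i) ^+ 2 <= \sum_(i < 2 ^ n) (a i) ^+ 2.
Proof.
rewrite dyadic_op_sqr; elim: n a => [|n IH] a.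
  by rewrite /half_sum !big_ord1 /= add0r tau0 expr0 expr1n mul1r divr1.
rewrite (sum_halves n (fun i => (a i) ^+ 2)).
apply: le_trans (lerD (IH a) (IH (upper_half n a))).
rewrite half_sumS /= (exprS 2 n).
set S1 := half_sum _ _; set S2 := half_sum _ _; set Q1 := haar_form _ _; set Q2 := haar_form _ _.
have P : (0 : R) < (2 ^+ n)^-1 by rewrite invr_gt0 exprn_gt0.
have e : tau n.+1 ^+ 2 <= tau n ^+ 2 by rewrite ler_sqr ?nnegrE // ltW.
rewrite invfM; set p := (2 ^+ n)^-1 in P *.
have : 0 <= (tau n ^+ 2 - tau n.+1 ^+ 2) * ((S1 ^+ 2 + S2 ^+ 2) * p).
  by rewrite mulr_ge0 ?subr_ge0 // mulr_ge0 ?(ltW P) // addr_ge0 ?sqr_ge0.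
lra.
Qed.

(** Induction over the scales.  The interval of length [2 ^ n.+1] has one half
    that is cut at [m], while the other half is kept or dropped entirely.  The
    mean of a half is controlled by the mean of the whole and by the Haar
    coefficient of the whole; as the square of the mean over a half carries half
    of the weight, passing to the smaller scale gains a factor that beats the
    growth [5 / 4] of the squared weights.  This leaves room for different
    constants for the Haar part and for the constants; [36] and [12] satisfy all
    the resulting inequalities. *)
Lemma haar_form_truncate n m a :
  haar_form n (truncate m a) + tau n ^+ 2 * half_sum n (truncate m a) ^+ 2 / 2 ^+ n
  <= 36 * haar_form n a + 12 * (tau n ^+ 2 * half_sum n a ^+ 2 / 2 ^+ n).
Proof.
elim: n m a => [|n IH] m a.
  rewrite /half_sum !big_ord1 /= tau0 expr0 expr1n !mul1r !divr1 mulr0 !add0r /truncate.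
  by case: ifP => _; have := sqr_ge0 (a 0%N); lra.
have p0 : (0 : R) < (2 ^+ n)^-1 by rewrite invr_gt0 exprn_gt0.
have t0 : (0 : R) <= tau n.+1 ^+ 2 by exact: sqr_ge0.
have t1 : tau n.+1 ^+ 2 <= tau n ^+ 2 by rewrite ler_sqr ?nnegrE // ltW.
have t2 := tau_slow n.
have IHa := IH m a; have IHu := IH (m - 2 ^ n)%N (upper_half n a).
rewrite !half_sumS /= (exprS 2 n) !invfM; move: IHa IHu.
have -> : haar_form n (upper_half n (truncate m a))
        = haar_form n (truncate (m - 2 ^ n) (upper_half n a)).
  apply: eq_haar_form => i _; rewrite /upper_half /truncate.
  by rewrite ltn_subRL.
have -> : half_sum n (upper_half n (truncate m a))
        = half_sum n (truncate (m - 2 ^ n) (upper_half n a)).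
  apply: eq_half_sum => i _; rewrite /upper_half /truncate.
  by rewrite ltn_subRL.
have Qa := haar_form_ge0 n a; have Qu := haar_form_ge0 n (upper_half n a).
move: p0 t0 t1 t2; set p := (2 ^+ n)^-1; set t := tau n ^+ 2; set t' := tau n.+1 ^+ 2.
move=> p0 t0 t1 t2.
have dec x : 0 <= (t - t') * (x ^+ 2 * p).
  by rewrite mulr_ge0 ?subr_ge0 // mulr_ge0 ?sqr_ge0 ?(ltW p0).
have slow x : 0 <= (5 / 4 * t' - t) * (x ^+ 2 * p).
  by rewrite mulr_ge0 ?subr_ge0 // mulr_ge0 ?sqr_ge0 ?(ltW p0).
have pos x : 0 <= t' * p * x ^+ 2.
  by rewrite mulr_ge0 ?sqr_ge0 // mulr_ge0 // (ltW p0).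
move: Qa Qu pos.
case: (leqP m (2 ^ n)) => [le_m|lt_m].
  have -> : (m - 2 ^ n = 0)%N by lia.
  have -> : truncate 0 (upper_half n a) = (fun=> 0) by [].
  rewrite haar_form0 half_sum0.
  move: (haar_form n (truncate m a)) (half_sum n (truncate m a)) => q s.
  move: (haar_form n a) (half_sum n a) => Q1 S1.
  move: (haar_form n (upper_half n a)) (half_sum n (upper_half n a)) => Q2 S2.
  move=> Qa Qu pos IHa _.
  (* With x the sum and y the difference of the two half sums, S1 = (x + y) / 2;
     the square of x - 2 y splits x y into (x ^ 2 + 4 y ^ 2) / 4, which is
     where the contraction factor 15 / 16 for x comes from. *)
  have := dec s; have := slow S1; have := pos ((S1 + S2) - 2 * (S1 - S2)).
  by have := pos (S1 + S2); have := pos (S1 - S2); lra.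
have -> : haar_form n (truncate m a) = haar_form n a.
  by apply: eq_haar_form => i li; rewrite /truncate (ltn_trans li).
have -> : half_sum n (truncate m a) = half_sum n a.
  by apply: eq_half_sum => i li; rewrite /truncate (ltn_trans li).
move: (haar_form n (truncate _ _)) (half_sum n (truncate _ _)) => q s.
move: (haar_form n a) (half_sum n a) => Q1 S1.
move: (haar_form n (upper_half n a)) (half_sum n (upper_half n a)) => Q2 S2.
move=> Qa Qu pos _ IHu.
have := dec s; have := slow S2; have := pos ((S1 + S2) - 2 * (S1 - S2)).
have := pos ((S1 + S2) + 2 * (S1 - S2)).
by have := pos (S1 + S2); have := pos (S1 - S2); lra.
Qed.

Lemma dyadic_op_truncate n m a :
  \sum_(i < 2 ^ n) (dyadic_op tau n (truncate m a) i) ^+ 2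
  <= 36 * \sum_(i < 2 ^ n) (dyadic_op tau n a i) ^+ 2.
Proof.
rewrite !dyadic_op_sqr; apply: le_trans (haar_form_truncate n m a) _.
rewrite mulrDr lerD2l ler_wpM2r //; last by lra.
by rewrite divr_ge0 ?exprn_ge0 // mulr_ge0 // sqr_ge0.
Qed.

Section Averages.
Variable lam : nat.
Hypothesis tau_lam : forall s, (s <= lam)%N -> tau s = 1.

Definition block_avg r a : R :=
  \sum_(j < 2 ^ r) half_sum lam (fun i => a (j * 2 ^ lam + i)%N) ^+ 2 / 2 ^+ lam.

Lemma block_avgS r a :
  block_avg r.+1 a = block_avg r a + block_avg r (upper_half (r + lam) a).
Proof.
rewrite /block_avg.
rewrite (sum_halves r (fun j =>
  half_sum lam (fun i => a (j * 2 ^ lam + i)%N) ^+ 2 / 2 ^+ lam)).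
congr (_ + _); apply: eq_bigr => j _; rewrite /upper_half; congr (_ ^+ _ / _).
by apply: eq_half_sum => i _; rewrite mulnDl -expnD addnA.
Qed.

Lemma dyadic_op_low n a i : (n <= lam)%N -> dyadic_op tau n a i = a i.
Proof.
elim: n a i => [//|n IH] a i lt_n /=; rewrite !(IH _ _ (ltnW lt_n)).
rewrite /jump !tau_lam ?(ltnW lt_n) // subrr mul0r !scale0r !subr0.
by case: ltnP => // le; rewrite /upper_half subnKC.
Qed.

(** The multiplier is the identity up to scale [lam].  At every larger scale the
    means of the intervals of length [2 ^ lam] account for what it shrinks; the
    extra term on the left carries the induction. *)
Lemma dyadic_op_block_avg r a : \sum_(i < 2 ^ (r + lam)) (a i) ^+ 2
  + tau (r + lam) ^+ 2 * half_sum (r + lam) a ^+ 2 / 2 ^+ (r + lam)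
  <= \sum_(i < 2 ^ (r + lam)) (dyadic_op tau (r + lam) a i) ^+ 2 + block_avg r a.
Proof.
elim: r a => [|r IH] a.
  under [X in _ <= X + _]eq_bigr do rewrite dyadic_op_low //.
  by rewrite /block_avg big_ord1 tau_lam // expr1n mul1r mul0n lexx.
have := lerD (IH a) (IH (upper_half (r + lam) a)).
rewrite addSn !dyadic_op_sqr block_avgS /= half_sumS.
rewrite (sum_halves (r + lam) (fun i => a i ^+ 2)).
have t0 : (0 : R) <= tau (r + lam).+1 ^+ 2 by exact: sqr_ge0.
have p0 : (0 : R) < (2 ^+ (r + lam))^-1 by rewrite invr_gt0 exprn_gt0.
rewrite (exprS 2 (r + lam)) invfM.
move: t0 p0; set p := (2 ^+ (r + lam))^-1; set t' := tau (r + lam).+1 ^+ 2.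
move: (half_sum _ _) (half_sum _ _) => S1 S2 t0 p0.
have A5 : 0 <= t' * p * (S1 - S2) ^+ 2.
  by rewrite mulr_ge0 ?sqr_ge0 // mulr_ge0 // (ltW p0).
rewrite /upper_half.
lra.
Qed.

Lemma frame_lower r a : \sum_(i < 2 ^ (r + lam)) (a i) ^+ 2
  <= \sum_(i < 2 ^ (r + lam)) (dyadic_op tau (r + lam) a i) ^+ 2 + block_avg r a.
Proof.
apply: le_trans (dyadic_op_block_avg r a); rewrite lerDl.
by rewrite divr_ge0 ?exprn_ge0 // mulr_ge0 // sqr_ge0.
Qed.

End Averages.

Lemma half_sum_sqr n a : half_sum n a ^+ 2 / 2 ^+ n <= \sum_(i < 2 ^ n) (a i) ^+ 2.
Proof.
elim: n a => [|n IH] a; first by rewrite /half_sum !big_ord1 expr0 divr1.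
rewrite (sum_halves n (fun i => (a i) ^+ 2)).
apply: le_trans (lerD (IH a) (IH (upper_half n a))).
have p0 : (0 : R) < (2 ^+ n)^-1 by rewrite invr_gt0 exprn_gt0.
rewrite half_sumS (exprS 2 n) invfM; move: p0; set p := (2 ^+ n)^-1.
move: (half_sum _ _) (half_sum _ _) => S1 S2 p0.
have A5 : 0 <= p * (S1 - S2) ^+ 2 by rewrite mulr_ge0 ?sqr_ge0 // ltW.
lra.
Qed.

Lemma block_avg_bessel lam r a :
  block_avg lam r a <= \sum_(i < 2 ^ (r + lam)) (a i) ^+ 2.
Proof.
elim: r a => [|r IH] a.
  rewrite /block_avg big_ord1; exact: half_sum_sqr.
rewrite block_avgS addSn (sum_halves (r + lam) (fun i => (a i) ^+ 2)).
exact: lerD.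
Qed.

(** The diagonal entry is [1 - \sum_(s < n) jump tau s].  As [tau 0 = tau 1],
    only scales [s >= 1] contribute, each at most half the decrease of [tau]. *)
Lemma dyadic_op_delta n i : (i < 2 ^ n)%N -> tau 1%N = 1 ->
  1 / 2 <= dyadic_op tau n (fun j => (j == i)%:R : R^o) i.
Proof.
move=> li tau1.
suff : dyadic_op tau n (fun j => (j == i)%:R : R^o) i >= 1 - (1 - tau n) / 2.
  by have := tau_gt0 n; lra.
elim: n i li => [|n IH] i; first by case: i => //= _; rewrite tau0; lra.
have J : jump tau n <= (tau n - tau n.+1) / 2.
  case: n {IH} => [|n]; first by rewrite /jump tau0 tau1 subrr !mul0r.
  rewrite /jump ler_wpM2l ?subr_ge0 // lef_pV2 ?posrE ?exprn_gt0 //.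
  by rewrite (exprS 2 n) ler_peMr // exprn_ege1 // ler1n.
have delta (c : nat -> R^o) k : (k < 2 ^ n)%N -> (forall j, c j = (j == k)%:R) ->
    \sum_(j < 2 ^ n) c j = 1.
  move=> lk ck; rewrite (bigD1 (Ordinal lk)) //= ck eqxx big1 ?addr0 // => j.
  by rewrite ck -val_eqE /= => /negPf ->.
move: i; apply: lt_halves => i li.
  rewrite dyadic_op_lo // (delta (fun j => (j == i)%:R : R^o) i) //.
  by have := IH i li; rewrite /GRing.scale /=; lra.
rewrite dyadic_op_hi (delta (upper_half n _) i) //; last by move=> j; rewrite /upper_half eqn_add2l.
have := IH i li.
rewrite (@eq_dyadic_op _ _ tau n (upper_half n _) (fun j => (j == i)%:R)) //.
  rewrite /GRing.scale /=; lra.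
by move=> j _; rewrite /upper_half eqn_add2l.
Qed.

End Weights.
End RealEstimates.

(** * Cutting the natural numbers into consecutive intervals *)

Section Blocks.
Variable k : nat -> nat.
Hypothesis k_gt0 : forall n, (0 < k n)%N.

Definition offset n := (\sum_(p < n) k p)%N.

(** The pair of the number of the interval that contains [m] and of the
    position of [m] in it is computed by stepping from [m] to [m.+1]. *)
Definition next_cell (c : nat * nat) : nat * nat :=
  if (c.2.+1 < k c.1)%N then (c.1, c.2.+1) else (c.1.+1, 0%N).

Definition cell m := iter m next_cell (0%N, 0%N).

Lemma offsetS n : offset n.+1 = (offset n + k n)%N.
Proof. by rewrite /offset big_ord_recr. Qed.

Lemma cellP m : ((cell m).2 < k (cell m).1)%N /\ m = (offset (cell m).1 + (cell m).2)%N.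
Proof.
elim: m => [|m [lt_m def_m]]; first by rewrite /cell /= k_gt0 /offset big_ord0.
rewrite [cell _]/(next_cell (cell m)) /next_cell; case: ifP => [lt_m1|ge_m1] /=.
  by split; rewrite // addnS -def_m.
split; first exact: k_gt0.
by rewrite addn0 offsetS {1}def_m -addnS; congr addn; lia.
Qed.

Lemma leq_offset n p : (n <= p)%N -> (offset n <= offset p)%N.
Proof.
by move=> le_np; rewrite -(subnKC le_np); elim: (p - n)%N => [|d IH];
   rewrite ?addn0 // addnS offsetS (leq_trans IH) // leq_addr.
Qed.

Lemma cell_offset n i : (i < k n)%N -> cell (offset n + i) = (n, i).
Proof.
move=> lt_i; set m := (offset n + i)%N; have [lt_m def_m] := cellP m.
have : (cell m).1 = n.
  case: (ltngtP (cell m).1 n) => // [lt|gt].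
    have := leq_offset lt; rewrite offsetS; rewrite /m in def_m lt_m *; lia.
  have := leq_offset gt; rewrite offsetS; rewrite /m in def_m lt_m *; lia.
case: (cell m) lt_m def_m => p j /= lt_m def_m e; rewrite e in def_m *; congr pair.
by move: def_m; rewrite /m; lia.
Qed.

Lemma leq_offset_id n : (n <= offset n)%N.
Proof. elim: n => // n IH; rewrite offsetS; have := k_gt0 n; lia. Qed.

Lemma lt_offset m n : (m < offset n)%N = ((cell m).1 < n)%N.
Proof.
have [lt_m def_m] := cellP m; case: (ltnP (cell m).1 n) => [lt|ge].
  have := leq_offset lt; rewrite offsetS; lia.
by have := leq_offset ge; lia.
Qed.

Lemma sum_offset (W : nmodType) (g : nat -> W) n :
  \sum_(m < offset n) g m = \sum_(p < n) \sum_(i < k p) g (offset p + i)%N.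
Proof.
elim: n => [|n IH]; first by rewrite /offset !big_ord0.
by rewrite offsetS big_split_ord /= IH [RHS]big_ord_recr.
Qed.

End Blocks.

(** * Real and imaginary parts of the scalars *)

Section RealParts.

(** What the proof needs of the scalars, whether real or complex: they contain
    the reals and have two real-linear coordinates with
    [`|x| ^ 2 = part1 x ^ 2 + part2 x ^ 2].  For real scalars the second
    coordinate is zero. *)
Record real_parts (R : realType) (K : numFieldType) (theta : K -> K) := RealParts {
  of_real : {rmorphism R -> K};
  part1 : {additive K -> R^o};
  part2 : {additive K -> R^o};
  ler_of_real : forall r s, (of_real r <= of_real s) = (r <= s);
  of_realK : cancel of_real part1;
  part1M : forall r x, part1 (of_real r * x) = r * part1 x;
  part2M : forall r x, part2 (of_real r * x) = r * part2 x;
  normr_parts : forall x, `|x| ^+ 2 = of_real (part1 x ^+ 2 + part2 x ^+ 2);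
  theta_real : forall r, theta (of_real r) = of_real r }.

Section Complex.
Variable R : realType.
(** These copies of the real and imaginary parts are additive on [R[i]] itself
    rather than on its underlying real vector space. *)
Definition complex_re (x : R[i]) : R^o := complex.Re x.
Definition complex_im (x : R[i]) : R^o := complex.Im x.
Lemma complex_re_additive : {morph complex_re : x y / x - y}.
Proof. by move=> [a b] [c d]. Qed.
Lemma complex_im_additive : {morph complex_im : x y / x - y}.
Proof. by move=> [a b] [c d]. Qed.
HB.instance Definition _ := GRing.isZmodMorphism.Build R[i] R^o complex_re complex_re_additive.
HB.instance Definition _ := GRing.isZmodMorphism.Build R[i] R^o complex_im complex_im_additive.
End Complex.

Lemma hilbert_scalars_parts (R : realType) (K : numFieldType) (theta : K -> K) :
  @hilbert_scalars R K theta -> inhabited (@real_parts R K theta).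
Proof.
case; constructor.
  refine (@RealParts R R idfun (idfun : {rmorphism R -> R})
    (idfun : {additive R -> R^o}) (\0 : {additive R -> R^o}) _ _ _ _ _ _) => //=.
  - by move=> r x; rewrite /GRing.null_fun mulr0.
  - by move=> x; rewrite /GRing.null_fun expr0n addr0 real_normK ?num_real.
refine (@RealParts R R[i] Num.conj (@real_complex_def R (Phant R) : {rmorphism R -> R[i]})
  (@complex_re R : {additive R[i] -> R^o}) (@complex_im R : {additive R[i] -> R^o})
  _ _ _ _ _ _) => //=.
- by move=> r s; rewrite lecR.
- by move=> r [a b]; rewrite /complex_re /= mul0r subr0.
- by move=> r [a b]; rewrite /complex_im /= mul0r addr0.
- by move=> x; rewrite -add_Re2_Im2.
- by move=> r; apply: conjc_real.
Qed.

End RealParts.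

(** * Inner products and orthonormal sequences *)

Section Scalars.
Variables (R : realType) (K : numFieldType) (theta : K -> K) (S : real_parts R theta).
Implicit Types (x y : K) (r s : R).

Definition sqmod x : R := part1 S x ^+ 2 + part2 S x ^+ 2.

Lemma sqmodE x : sqmod x = part1 S x ^+ 2 + part2 S x ^+ 2.
Proof. by []. Qed.

Lemma of_real_inj : injective (of_real S).
Proof. exact: can_inj (of_realK S). Qed.

Lemma normr_sqmod x : `|x| ^+ 2 = of_real S (sqmod x).
Proof. exact: normr_parts. Qed.

Lemma sqmod_ge0 x : 0 <= sqmod x.
Proof. by rewrite addr_ge0 // sqr_ge0. Qed.

Lemma of_real_ge0 r : (0 <= of_real S r) = (0 <= r).
Proof. by rewrite -(rmorph0 (of_real S)) ler_of_real. Qed.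

Lemma ltr_of_real r s : (of_real S r < of_real S s) = (r < s).
Proof. by rewrite !lt_neqAle ler_of_real (inj_eq of_real_inj). Qed.

Lemma of_real_gt0 r : (0 < of_real S r) = (0 < r).
Proof. by rewrite -(rmorph0 (of_real S)) ltr_of_real. Qed.

Lemma nneg_real x : 0 <= x -> x = of_real S (part1 S x).
Proof.
move=> x0; suff [r ->] : exists r, x = of_real S r by rewrite of_realK.
exists (Num.sqrt (sqmod x)); apply/eqP.
rewrite -(@eqrXn2 _ 2) ?of_real_ge0 ?sqrtr_ge0 // -rmorphXn /= sqr_sqrtr ?sqmod_ge0 //.
by rewrite -normr_sqmod ger0_norm.
Qed.

Lemma sqmodM x y : sqmod (x * y) = sqmod x * sqmod y.
Proof.
by apply: of_real_inj; rewrite rmorphM -!normr_sqmod normrM exprMn.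
Qed.

Lemma sqmod0 : sqmod 0 = 0.
Proof. by rewrite /sqmod !raddf0 expr0n addr0. Qed.

Lemma sqmod_real r : sqmod (of_real S r) = r ^+ 2.
Proof.
apply: of_real_inj; rewrite -normr_sqmod real_normK ?rmorphXn //.
case: (lerP 0 r) => [r0|r0]; first by rewrite ger0_real // of_real_ge0.
by rewrite ler0_real // -oppr_ge0 -rmorphN of_real_ge0 oppr_ge0 ltW.
Qed.

Lemma sqmod_eq0 x : (sqmod x == 0) = (x == 0).
Proof.
apply/eqP/eqP => [e|->]; last exact: sqmod0.
by apply/eqP; rewrite -normr_eq0 -sqrf_eq0 normr_sqmod e rmorph0.
Qed.

Lemma sqmod_sub x y : sqmod (x - y) <= 2 * (sqmod x + sqmod y).
Proof.
rewrite /sqmod !raddfB.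
have := sqr_ge0 (part1 S x + part1 S y); have := sqr_ge0 (part2 S x + part2 S y).
move: (part1 S x) (part1 S y) (part2 S x) (part2 S y) => a b c d; rewrite /= in a b c d *.
lra.
Qed.

Section Hilbert.
Variables (H : completeNormedModType K) (ip : {dot H for theta}).
Hypothesis hip : norm_from_dot ip.
Implicit Types (u v w : H).

Lemma ipDl u v w : ip (u + v) w = ip u w + ip v w.
Proof. exact: linearDl. Qed.

Lemma ipDr u v w : ip u (v + w) = ip u v + ip u w.
Proof. exact: linearDr. Qed.

Lemma ipNl u v : ip (- u) v = - ip u v.
Proof. exact: linearNl. Qed.

Lemma ipNr u v : ip u (- v) = - ip u v.
Proof. exact: linearNr. Qed.

Lemma ipZl x u v : ip (x *: u) v = x * ip u v.
Proof. exact: linearZl_LR. Qed.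

Lemma ipZr x u v : ip u (x *: v) = theta x * ip u v.
Proof. exact: linearZr_LR. Qed.

Lemma ip_suml I (r : seq I) (P : pred I) (g : I -> H) v :
  ip (\sum_(i <- r | P i) g i) v = \sum_(i <- r | P i) ip (g i) v.
Proof. exact: linear_sumlz. Qed.

Lemma ip_sumr I (r : seq I) (P : pred I) (g : I -> H) v :
  ip v (\sum_(i <- r | P i) g i) = \sum_(i <- r | P i) ip v (g i).
Proof. exact: linear_sumr. Qed.

Lemma ip0l v : ip 0 v = 0.
Proof. exact: linear0l. Qed.

Definition sqnorm v : R := part1 S (ip v v).

Lemma normr_sqnorm v : `|v| ^+ 2 = of_real S (sqnorm v).
Proof. by rewrite [LHS]nneg_real ?exprn_ge0 // hip. Qed.

Lemma ipvv v : ip v v = of_real S (sqnorm v).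
Proof. by rewrite -hip normr_sqnorm. Qed.

Lemma sqnorm_ge0 v : 0 <= sqnorm v.
Proof. by rewrite -of_real_ge0 -normr_sqnorm exprn_ge0. Qed.

Lemma sqnormZ x v : sqnorm (x *: v) = sqmod x * sqnorm v.
Proof.
apply: of_real_inj; rewrite rmorphM -!normr_sqnorm -normr_sqmod.
by rewrite normrZ exprMn.
Qed.

Lemma sqnorm0 : sqnorm 0 = 0.
Proof. by rewrite /sqnorm ip0l raddf0. Qed.

Lemma sqnorm_eq0 v : (sqnorm v == 0) = (v == 0).
Proof.
apply/eqP/eqP => [e|->]; last exact: sqnorm0.
by apply/eqP; rewrite -normr_eq0 -sqrf_eq0 normr_sqnorm e rmorph0.
Qed.

Lemma sqnormN v : sqnorm (- v) = sqnorm v.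
Proof. by apply: of_real_inj; rewrite -!normr_sqnorm normrN. Qed.

Lemma sqnorm_parallelogram u v :
  sqnorm (u + v) + sqnorm (u - v) = 2 * (sqnorm u + sqnorm v).
Proof.
rewrite /sqnorm !(ipDl, ipDr, ipNl, ipNr) !raddfD !raddfN /=.
ring.
Qed.

Lemma sqnorm_sub u v : sqnorm (u - v) <= 2 * (sqnorm u + sqnorm v).
Proof. by rewrite -sqnorm_parallelogram lerDr sqnorm_ge0. Qed.

Lemma theta0 : theta 0 = 0.
Proof. by rewrite -(rmorph0 (of_real S)) theta_real. Qed.

Lemma ipC u v : ip u v = theta (ip v u).
Proof. by have := @hermitian_subproof _ _ _ _ ip u v; rewrite expr0 mul1r. Qed.

Lemma ip0C u v : ip u v = 0 -> ip v u = 0.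
Proof. by move=> e; rewrite ipC e theta0. Qed.

Lemma pythagoras u v : ip u v = 0 -> sqnorm (u + v) = sqnorm u + sqnorm v.
Proof.
move=> e; rewrite /sqnorm !(ipDl, ipDr) e (ip0C e) !raddfD /= raddf0.
by rewrite addr0 add0r.
Qed.

Lemma ipZr_real r u v : ip u (of_real S r *: v) = of_real S r * ip u v.
Proof. by rewrite ipZr theta_real. Qed.

(** Bessel's inequality for one unit vector: it makes the coordinates continuous. *)
Lemma sqmod_ip u v : sqnorm v = 1 -> sqmod (ip u v) <= sqnorm u.
Proof.
move=> v1; set w := u - ip u v *: v.
have e : ip w v = 0 by rewrite /w ipDl ipNl ipZl ipvv v1 rmorph1 mulr1 subrr.
rewrite -[u in leRHS](subrK (ip u v *: v)) -/w pythagoras ?sqnormZ ?v1 ?mulr1 ?lerDr ?sqnorm_ge0 //.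
by rewrite ipZr e mulr0.
Qed.

Lemma cvg_sqnorm (u : nat -> H) (l : H) :
  (forall e : R, 0 < e -> exists N, forall n, (N <= n)%N -> sqnorm (l - u n) < e) <->
  u @ \oo --> l.
Proof.
split=> [h|/cvgrPdist_lt h e e0].
  apply/cvgrPdist_lt => e e0.
  have ee := nneg_real (ltW e0); rewrite ee of_real_gt0 in e0.
  have [N hN] := h (part1 S e ^+ 2) (exprn_gt0 _ e0).
  exists N => // n /= /hN; rewrite -ltr_of_real -normr_sqnorm rmorphXn /= -ee.
  by rewrite ltr_pXn2r // nnegrE // ee of_real_ge0 ltW.
have se : 0 < Num.sqrt e by rewrite sqrtr_gt0.
have [|N _ hN] := h (of_real S (Num.sqrt e)); first by rewrite of_real_gt0.
exists N => n /hN /=; rewrite -ltr_of_real -normr_sqnorm => lt.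
rewrite -(sqr_sqrtr (ltW e0)) rmorphXn /=.
by rewrite ltr_pXn2r // nnegrE // of_real_ge0 ltW.
Qed.

Lemma cvgn_sqnorm (u : nat -> H) :
  (forall e : R, 0 < e -> exists N, forall n, (N <= n)%N -> sqnorm (u N - u n) < e) ->
  cvgn u.
Proof.
move=> h; apply/cauchy_cvgP/cauchy_exP => e e0.
have ee := nneg_real (ltW e0); rewrite ee of_real_gt0 in e0.
have [N hN] := h (part1 S e ^+ 2) (exprn_gt0 _ e0).
exists (u N); exists N => // n /= /hN; rewrite -ltr_of_real -normr_sqnorm rmorphXn /= -ee.
rewrite -ball_normE /ball_ /=.
by rewrite ltr_pXn2r // nnegrE // ee of_real_ge0 ltW.
Qed.

Lemma cvgn_sqnorm_cauchy (u : nat -> H) : cvgn u ->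
  forall e : R, 0 < e -> exists N, forall n p, (N <= n)%N -> (N <= p)%N -> sqnorm (u p - u n) < e.
Proof.
move=> /cvg_ex [l /cvg_sqnorm h] e e0.
have [|N hN] := h (e / 4); first by rewrite divr_gt0.
exists N => n p /hN n1 /hN n2.
have -> : u p - u n = (l - u n) - (l - u p) by rewrite opprB [RHS]addrC addrA subrK.
have := sqnorm_sub (l - u n) (l - u p); lra.
Qed.

Section Orthonormal.
Variable b : nat -> H.
Hypothesis orthonormal_b : forall i j, ip (b i) (b j) = (i == j)%:R.

Lemma sqnorm_b i : sqnorm (b i) = 1.
Proof. by rewrite /sqnorm orthonormal_b eqxx -(rmorph1 (of_real S)) of_realK. Qed.

Lemma ip_sumb n (a : nat -> K) j :
  ip (\sum_(i < n) a i *: b i) (b j) = if (j < n)%N then a j else 0.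
Proof.
rewrite ip_suml; under eq_bigr do rewrite ipZl orthonormal_b.
case: ltnP => [lt_j|ge_j].
  rewrite (bigD1 (Ordinal lt_j)) //= eqxx mulr1 big1 ?addr0 // => i.
  by rewrite -val_eqE /= => /negPf ->; rewrite mulr0.
rewrite big1 // => i _; case: eqP => [e|]; rewrite ?mulr0 //.
by have := ltn_ord i; rewrite e ltnNge ge_j.
Qed.

Lemma sqnorm_sumb n (a : nat -> K) :
  sqnorm (\sum_(i < n) a i *: b i) = \sum_(i < n) sqmod (a i).
Proof.
elim: n => [|n IH]; first by rewrite !big_ord0 sqnorm0.
rewrite !big_ord_recr /= pythagoras ?IH ?sqnormZ ?sqnorm_b ?mulr1 //.
by rewrite ipZr ip_sumb ltnn mulr0.
Qed.

Definition proj n v := \sum_(i < n) ip v (b i) *: b i.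

Lemma ip_proj n v j : (j < n)%N -> ip (v - proj n v) (b j) = 0.
Proof. by move=> lt_j; rewrite ipDl ipNl (ip_sumb n (fun i => ip v (b i))) lt_j subrr. Qed.

Lemma bessel_eq n v :
  sqnorm v = \sum_(i < n) sqmod (ip v (b i)) + sqnorm (v - proj n v).
Proof.
rewrite -(sqnorm_sumb n (fun i => ip v (b i))) addrC -pythagoras ?subrK //.
rewrite ip_sumr big1 // => i _; rewrite ipZr ip_proj ?mulr0 //.
Qed.

Lemma bessel n v : \sum_(i < n) sqmod (ip v (b i)) <= sqnorm v.
Proof. by rewrite (bessel_eq n v) lerDl sqnorm_ge0. Qed.

End Orthonormal.
End Hilbert.
End Scalars.

(** * Existence of an orthonormal basis *)

Section GramSchmidt.
Variables (R : realType) (K : numFieldType) (theta : K -> K) (S : real_parts R theta).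
Variables (H : completeNormedModType K) (ip : {dot H for theta}).
Hypothesis hip : norm_from_dot ip.
Implicit Types (u v w : H) (s : seq H).

Local Notation sqnorm := (sqnorm S ip).

Definition residual s v := v - \sum_(w <- s) ip v w *: w.

Definition orthonormal_seq s :=
  (forall w, w \in s -> ip w w = 1) /\
  (forall w, w \in s -> forall v, ip (residual s v) w = 0).

Lemma residual_rcons s w v : residual (rcons s w) v = residual s v - ip v w *: w.
Proof. by rewrite /residual -cats1 big_cat big_seq1 /= opprD addrA. Qed.

Lemma residual_sub s u v : residual s v = 0 -> residual s (u - v) = residual s u.
Proof.
move=> /eqP; rewrite subr_eq0 => /eqP ev; rewrite /residual.
under eq_bigr do rewrite ipDl ipNl scalerBl.
by rewrite sumrB -ev opprB addrA subrK.
Qed.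

Lemma sqnorm_residual s v : orthonormal_seq s -> sqnorm (residual s v) <= sqnorm v.
Proof.
move=> [_ os].
have e : ip (residual s v) (\sum_(w <- s) ip v w *: w) = 0.
  by rewrite ip_sumr big_seq big1 // => w ws; rewrite ipZr os // mulr0.
rewrite -[v in leRHS](subrK (\sum_(w <- s) ip v w *: w)) -[_ - _]/(residual s v).
by rewrite (pythagoras S e) lerDl (sqnorm_ge0 S hip).
Qed.

Lemma orthonormal_seq_rcons s w : orthonormal_seq s -> ip w w = 1 ->
  (forall v, v \in s -> ip w v = 0) -> orthonormal_seq (rcons s w).
Proof.
move=> [n1 os] ww sw; split=> v; rewrite mem_rcons inE => /orP[/eqP->|vs].
- exact: ww.
- exact: n1.
- move=> u; rewrite residual_rcons ipDl ipNl ipZl ww mulr1 /residual ipDl ipNl ip_suml.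
  rewrite big_seq big1 ?subr0 ?subrr // => x xs.
  by rewrite ipZl (ip0C S (sw _ xs)) mulr0.
- by move=> u; rewrite residual_rcons ipDl ipNl ipZl os // sw // mulr0 subr0.
Qed.

Hypothesis hsep : separable H.
Hypothesis hdim : ~ finite_dimensional H.

Lemma dense_sequence : exists d : nat -> H,
  forall v (e : R), 0 < e -> exists n, sqnorm (v - d n) < e.
Proof.
have [D /countable_injP[g ginj] Dd] := hsep.
exists (fun n => xget 0 [set v | D v /\ g v = n]) => v e e0.
have se : 0 < Num.sqrt e by rewrite sqrtr_gt0.
have r0 : 0 < of_real S (Num.sqrt e) by rewrite of_real_gt0.
have [|w [wb wD]] := Dd (ball v (of_real S (Num.sqrt e))) _ (ball_open _ _).
  by exists v; apply: ballxx.
exists (g w); rewrite (@xget_unique _ _ _ w) //=; last first.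
  by move=> u [uD gu]; apply: ginj; rewrite ?inE.
rewrite -(ltr_of_real S) -(normr_sqnorm S hip) -(sqr_sqrtr (ltW e0)) rmorphXn /=.
by rewrite ltr_pXn2r // ?nnegrE // ?ltW //; move: wb; rewrite -ball_normE.
Qed.

Section Sequence.
Variable d : nat -> H.
Hypothesis dense_d : forall v (e : R), 0 < e -> exists n, sqnorm (v - d n) < e.

(** If every [d k] were in the span of [s], then so would be every vector, by
    density and because residuals are contractions; this is excluded by the
    infinite dimension.  Otherwise the first [d k] outside the span is normalized
    after projection.  Taking the first one ensures that all [d k] are reached. *)
Lemma orthonormal_step s : exists w, orthonormal_seq s ->
  orthonormal_seq (rcons s w) /\
  exists k, [/\ residual s (d k) != 0,
    forall j, (j < k)%N -> residual s (d j) = 0 & residual (rcons s w) (d k) = 0].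
Proof.
case: (pselect (orthonormal_seq s)) => [os|nos]; last by exists 0.
case: (pselect (exists k, residual s (d k) != 0)) => [ex|nex]; last first.
  exfalso; apply: hdim; exists (size s), (fun i => s`_i) => v.
  exists (fun i => ip v s`_i).
  have -> : \sum_(i < size s) ip v s`_i *: s`_i = \sum_(w <- s) ip v w *: w.
    by rewrite (big_nth 0) big_mkord.
  apply/eqP; rewrite -subr_eq0 -/(residual s v) -(sqnorm_eq0 S hip).
  rewrite eq_le (sqnorm_ge0 S hip) andbT leNgt; apply/negP => /(dense_d v)[n].
  have d0 : residual s (d n) = 0 by apply/eqP/negPn/negP => h; apply: nex; exists n.
  by rewrite ltNge -(residual_sub v d0) sqnorm_residual.
pose k := ex_minn ex; have [rk mink] : residual s (d k) != 0 /\
    forall j, residual s (d j) != 0 -> (k <= j)%N by rewrite /k; case: ex_minnP.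
set r := residual s (d k) in rk *.
have nr : `|r| != 0 by rewrite normr_eq0.
exists (`|r|^-1 *: r) => _.
have thr x : 0 <= x -> theta x = x.
  by move=> /(nneg_real S) ->; rewrite theta_real.
have ww : ip (`|r|^-1 *: r) (`|r|^-1 *: r) = 1.
  by rewrite ipZl ipZr thr ?invr_ge0 // -hip mulrA -expr2 -exprMn mulVf // expr1n.
have sw v : v \in s -> ip (`|r|^-1 *: r) v = 0.
  by move=> vs; rewrite ipZl os.2 // mulr0.
split; first exact: orthonormal_seq_rcons.
exists k; split=> // [j lt_j|].
  by apply/eqP/negPn/negP => /mink; rewrite leqNgt lt_j.
rewrite residual_rcons -/r ipZr thr ?invr_ge0 //.
have -> : ip (d k) r = ip r r.
  rewrite -[d k](subrK (\sum_(w <- s) ip (d k) w *: w)) ipDl -/(residual s (d k)) -/r ip_suml.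
  rewrite big_seq big1 ?addr0 // => w ws.
  by rewrite ipZl (ip0C S (os.2 _ ws _)) mulr0.
rewrite scalerA mulrAC -hip -expr2 -exprMn mulVf // expr1n scale1r subrr //.
Qed.

(** After [n] steps the span contains [d 0], ..., [d n.-1], so the partial
    sums of the expansion of [v] are at least as close to [v] as these. *)
Lemma gram_schmidt_dense : exists b : nat -> H,
  (forall i j, ip (b i) (b j) = (i == j)%:R) /\
  forall v, (fun n => proj ip b n v) @ \oo --> v.
Proof.
have [next nextP] := choice orthonormal_step.
pose bs := fix bs n := if n is p.+1 then rcons (bs p) (next (bs p)) else [::].
pose b n := next (bs n).
have os n : orthonormal_seq (bs n).
  by elim: n => [|n IH]; [split | case: (nextP _ IH)].
have def_bs n : bs n = mkseq b n.
  by elim: n => // n IH; rewrite /= mkseqS -IH.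
have lt_ip i j : (i < j)%N -> ip (b j) (b i) = 0.
  move=> lt_ij; have [_ /(_ (b i))] := os j.+1.
  have bi : b i \in bs j by rewrite def_bs; apply: map_f; rewrite mem_iota.
  have [_ oj] := os j; rewrite /= mem_rcons inE bi orbT => /(_ isT (b j)).
  rewrite residual_rcons ipDl ipNl ipZl oj // sub0r => /eqP; rewrite oppr_eq0.
  have [nj _] := os j.+1; rewrite -/(b j) nj ?mul1r; first by move/eqP.
  by rewrite /= mem_rcons mem_head.
have ob i j : ip (b i) (b j) = (i == j)%:R.
  case: (ltngtP i j) => [/lt_ip/(ip0C S)|/lt_ip|->] //.
  by have [nj _] := os j.+1; apply: nj; rewrite /= mem_rcons mem_head.
exists b; split=> // v.
have res n u : residual (bs n) u = u - proj ip b n u.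
  rewrite /residual def_bs /proj big_map.
  by rewrite -(big_mkord xpredT (fun i => ip u (b i) *: b i)) /index_iota subn0.
have keep n u : residual (bs n) u = 0 -> residual (bs n.+1) u = 0.
  move=> r0; rewrite /= residual_rcons r0 sub0r -/(b n).
  move: r0; rewrite res => /eqP; rewrite subr_eq0 => /eqP ->.
  by rewrite (ip_sumb ob n (fun i => ip u (b i))) ltnn scale0r oppr0.
have res0 n j : (j < n)%N -> residual (bs n) (d j) = 0.
  elim: n j => // n IH j; rewrite ltnS leq_eqVlt => /orP[/eqP->|/IH/keep//].
  have [_ [k [rk kmin rk']]] := nextP _ (os n).
  case: (ltngtP n k) => [/kmin/keep//|/IH r0|e]; last first.
    by rewrite (congr1 d e).
  by rewrite r0 eqxx in rk.
apply: (iffLR (cvg_sqnorm S hip (fun n => proj ip b n v) v)) => e e0.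
have [k hk] := dense_d v e0.
exists k.+1 => n lt_kn; apply: le_lt_trans hk.
by rewrite -res -(residual_sub v (res0 _ _ lt_kn)) sqnorm_residual.
Qed.

End Sequence.

Lemma orthonormal_basis_exists : exists b : nat -> H,
  (forall i j, ip (b i) (b j) = (i == j)%:R) /\
  forall v, (fun n => proj ip b n v) @ \oo --> v.
Proof. by have [d /gram_schmidt_dense] := dense_sequence. Qed.

End GramSchmidt.

(** * Leaves and means in one block *)

Section Block.
Variables (R : realType) (K : numFieldType) (theta : K -> K) (S : real_parts R theta).
Variables (H : completeNormedModType K) (ip : {dot H for theta}).
Hypothesis hip : norm_from_dot ip.
Local Notation sqnorm := (sqnorm S ip).
Local Notation sqmod := (sqmod S).

Variable tau : nat -> R^o.
Hypothesis tau0 : tau 0%N = 1.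
Hypothesis tau_gt0 : forall s, 0 < tau s.
Hypothesis tau_dec : forall s, tau s.+1 <= tau s.
Hypothesis tau_slow : forall s, tau s ^+ 2 <= 5 / 4 * tau s.+1 ^+ 2.
Variables lam r : nat.
Hypothesis lam_gt0 : (0 < lam)%N.
Hypothesis tau_lam : forall s, (s <= lam)%N -> tau s = 1.
Local Notation N := (r + lam)%N.

Definition scalar_weight s : K := of_real S (tau s).
Local Notation op := (dyadic_op scalar_weight).

Lemma jump_weight s : jump scalar_weight s = of_real S (jump tau s).
Proof. by rewrite /jump rmorphM rmorphB fmorphV rmorphXn rmorph_nat. Qed.

Lemma sqmod_op n (a : nat -> K^o) i : sqmod (op n a i)
  = dyadic_op tau n (part1 S \o a) i ^+ 2 + dyadic_op tau n (part2 S \o a) i ^+ 2.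
Proof.
rewrite !sqmodE; congr (_ ^+ 2 + _ ^+ 2).
  apply: (@dyadic_op_map K R K^o R^o (part1 S) scalar_weight tau) => s x.
  by rewrite jump_weight; apply: part1M.
apply: (@dyadic_op_map K R K^o R^o (part2 S) scalar_weight tau) => s x.
by rewrite jump_weight; apply: part2M.
Qed.

Lemma op_bessel n (a : nat -> K^o) :
  \sum_(i < 2 ^ n) sqmod (op n a i) <= \sum_(i < 2 ^ n) sqmod (a i).
Proof.
under eq_bigr do rewrite sqmod_op.
by rewrite !big_split lerD //=; apply: dyadic_op_bessel.
Qed.

Lemma op_truncation n m (a : nat -> K^o) :
  \sum_(i < 2 ^ n) sqmod (op n (fun i => if (i < m)%N then a i else 0) i)
  <= 36 * \sum_(i < 2 ^ n) sqmod (op n a i).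
Proof.
have E (g : {additive K -> R^o}) : g \o (fun i => if (i < m)%N then a i else 0)
    = truncate m (g \o a).
  by apply: funext => i; rewrite /truncate /=; case: ifP => _; rewrite ?raddf0.
under eq_bigr do rewrite sqmod_op !E.
under [in leRHS]eq_bigr do rewrite sqmod_op.
by rewrite !big_split mulrDr lerD //=; apply: dyadic_op_truncate.
Qed.

Definition mean_square (a : nat -> K) : R :=
  \sum_(j < 2 ^ r) sqmod (\sum_(i < 2 ^ lam) a (j * 2 ^ lam + i)%N) / 2 ^+ lam.

Lemma mean_square_parts (a : nat -> K) :
  mean_square a = block_avg lam r (part1 S \o a) + block_avg lam r (part2 S \o a).
Proof.
rewrite -big_split /=; apply: eq_bigr => j _.
by rewrite -mulrDl !sqmodE !raddf_sum.
Qed.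

Lemma op_frame_lower (a : nat -> K^o) : \sum_(i < 2 ^ N) sqmod (a i)
  <= \sum_(i < 2 ^ N) sqmod (op N a i) + mean_square a.
Proof.
under [in leRHS]eq_bigr do rewrite sqmod_op.
rewrite !big_split mean_square_parts addrACA lerD //=; exact: frame_lower.
Qed.

Lemma mean_square_bessel (a : nat -> K^o) :
  mean_square a <= \sum_(i < 2 ^ N) sqmod (a i).
Proof. by rewrite big_split mean_square_parts lerD //=; apply: block_avg_bessel. Qed.

(** The weights are nonzero, so the multiplier is invertible; no bound for the
    inverse that is uniform in [n] is available, only that of truncation. *)
Lemma op_surj n (c : nat -> K^o) : exists a : nat -> K^o,
  forall i, (i < 2 ^ n)%N -> op n a i = c i.
Proof.
exists (dyadic_op (fun s => (scalar_weight s)^-1) n c) => i lt_i.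
apply: (dyadic_op_inv (n := n)) => // [s|]; last by rewrite /scalar_weight tau0 rmorph1.
by rewrite divff // gt_eqF // of_real_gt0.
Qed.

Lemma op_inj n (a : nat -> K^o) : (forall i, (i < 2 ^ n)%N -> op n a i = 0) ->
  forall i, (i < 2 ^ n)%N -> a i = 0.
Proof.
move=> h i lt_i.
have tK : forall s, (scalar_weight s)^-1 * scalar_weight s = 1.
  by move=> s; rewrite mulVf // gt_eqF // of_real_gt0.
rewrite -(dyadic_op_inv a tK _ lt_i); last by rewrite /scalar_weight tau0 rmorph1 invr1.
rewrite (@eq_dyadic_op _ _ _ _ _ (fun=> 0)) // (@dyadic_op_cst _ _ _ n) ?scaler0 //.
by rewrite /scalar_weight tau0 rmorph1 invr1.
Qed.

Variable e : nat -> H.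
Hypothesis orthonormal_e : forall i j, ip (e i) (e j) = (i == j)%:R.

Definition leaf_vec i : H := op N e i.
Definition mean_vec j : H := \sum_(i < 2 ^ lam) e (j * 2 ^ lam + i)%N.

Lemma sum_leaf_vec (a : nat -> K^o) :
  \sum_(i < 2 ^ N) a i *: leaf_vec i = \sum_(i < 2 ^ N) (op N a i : K) *: e i.
Proof. exact: dyadic_op_sym. Qed.

Lemma sqnorm_sum_leaf (a : nat -> K^o) :
  sqnorm (\sum_(i < 2 ^ N) a i *: leaf_vec i) = \sum_(i < 2 ^ N) sqmod (op N a i).
Proof.
rewrite sum_leaf_vec; exact: (sqnorm_sumb S hip orthonormal_e (2 ^ N) (op N a)).
Qed.

(** The square of the basis constant of the leaves of one block is at most
    [36], whatever the length of the block. *)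
Lemma sqnorm_leaf_truncate m (a : nat -> K^o) : (m <= 2 ^ N)%N ->
  sqnorm (\sum_(i < m) a i *: leaf_vec i)
  <= 36 * sqnorm (\sum_(i < 2 ^ N) a i *: leaf_vec i).
Proof.
move=> le_m.
have -> : \sum_(i < m) a i *: leaf_vec i =
    \sum_(i < 2 ^ N) (if (i < m)%N then a i else 0) *: leaf_vec i.
  rewrite (big_ord_widen _ (fun i => a i *: leaf_vec i) le_m) big_mkcond /=.
  by apply: eq_bigr => i _; case: ifP => // _; rewrite scale0r.
rewrite (sqnorm_sum_leaf (fun i => if (i < m)%N then a i else 0)) sqnorm_sum_leaf.
exact: op_truncation.
Qed.

Lemma leaf_vec_delta i : (i < 2 ^ N)%N ->
  leaf_vec i = \sum_(j < 2 ^ N) (op N (fun j => (j == i)%:R : K^o) j : K) *: e j.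
Proof.
move=> lt_i; rewrite -sum_leaf_vec (bigD1 (Ordinal lt_i)) //= eqxx scale1r big1 ?addr0 // => j.
by rewrite -val_eqE /= => /negPf ->; rewrite scale0r.
Qed.

Lemma sqnorm_leaf_le1 i : (i < 2 ^ N)%N -> sqnorm (leaf_vec i) <= 1.
Proof.
move=> lt_i; rewrite leaf_vec_delta //.
rewrite (sqnorm_sumb S hip orthonormal_e (2 ^ N) (op N (fun j => (j == i)%:R : K^o))).
apply: le_trans (op_bessel _ _) _.
rewrite (bigD1 (Ordinal lt_i)) //= eqxx big1 ?addr0 => [|j].
  by rewrite -(rmorph1 (of_real S)) sqmod_real expr1n.
by rewrite -val_eqE /= => /negPf ->; rewrite sqmod0.
Qed.

(** The coordinate of the leaf at its own index is at least [1 / 2]. *)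
Lemma sqnorm_leaf_ge i : (i < 2 ^ N)%N -> 1 / 4 <= sqnorm (leaf_vec i).
Proof.
move=> lt_i; apply: le_trans _ (sqmod_ip hip (leaf_vec i) (sqnorm_b S orthonormal_e i)).
rewrite leaf_vec_delta //.
rewrite (ip_sumb orthonormal_e (2 ^ N) (op N (fun j => (j == i)%:R : K^o))) lt_i.
rewrite sqmod_op.
have -> : part1 S \o (fun j => (j == i)%:R) = (fun j => (j == i)%:R : R^o).
  by apply: funext => j /=; rewrite -(rmorph_nat (of_real S)) of_realK.
have := dyadic_op_delta tau0 tau_gt0 tau_dec lt_i (tau_lam lam_gt0).
move: (dyadic_op _ _ _ _) (dyadic_op _ _ _ _) => x y; rewrite /= in x y * => hx.
have := sqr_ge0 x; have := sqr_ge0 (y - 1 / 2); lra.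
Qed.

Lemma ip_mean_vec j i : ip (mean_vec j) (e i) = (i %/ 2 ^ lam == j)%N%:R.
Proof.
have P : (0 < 2 ^ lam)%N by rewrite expn_gt0.
rewrite /mean_vec ip_suml; under eq_bigr do rewrite orthonormal_e.
case: eqP => [<-|ne].
  rewrite (bigD1 (Ordinal (ltn_pmod i P))) //= -divn_eq eqxx big1 ?addr0 // => k.
  rewrite -val_eqE /= => ne; case: eqP => // e0; case/eqP: ne.
  by rewrite -[in RHS]e0 modnMDl modn_small.
rewrite big1 // => k _; case: eqP => // e0; case: ne.
by rewrite -e0 divnMDl // divn_small ?addn0.
Qed.

Lemma sqnorm_mean_vec j : sqnorm (mean_vec j) = 2 ^+ lam.
Proof.
have o i k : ip (e (j * 2 ^ lam + i)) (e (j * 2 ^ lam + k)) = (i == k)%:R.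
  by rewrite orthonormal_e eqn_add2l.
rewrite /mean_vec -[RHS](_ : \sum_(i < 2 ^ lam) sqmod 1 = _); last first.
  by rewrite -(rmorph1 (of_real S)) sqmod_real expr1n sumr_const card_ord natrX.
rewrite -(sqnorm_sumb S hip o (2 ^ lam) (fun=> 1)).
by under [in RHS]eq_bigr do rewrite scale1r.
Qed.

Lemma ip_leaf_vec v i : ip v (leaf_vec i) = op N (fun j => ip v (e j) : K^o) i.
Proof.
apply: (@dyadic_op_map K K H K^o (ip v) scalar_weight scalar_weight) => s x.
by rewrite jump_weight; apply: (ipZr_real S).
Qed.

Lemma ip_mean v j : ip v (mean_vec j) = \sum_(i < 2 ^ lam) ip v (e (j * 2 ^ lam + i)%N).
Proof. exact: ip_sumr. Qed.

Lemma block_frame_lower v : \sum_(i < 2 ^ N) sqmod (ip v (e i))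
  <= \sum_(i < 2 ^ N) sqmod (ip v (leaf_vec i))
     + \sum_(j < 2 ^ r) sqmod (ip v (mean_vec j)) / 2 ^+ lam.
Proof.
under [X in _ <= X + _]eq_bigr do rewrite ip_leaf_vec.
under [X in _ <= _ + X]eq_bigr do rewrite ip_mean.
exact: (op_frame_lower (fun j => ip v (e j))).
Qed.

Lemma block_leaf_bessel v : \sum_(i < 2 ^ N) sqmod (ip v (leaf_vec i))
  <= \sum_(i < 2 ^ N) sqmod (ip v (e i)).
Proof. under eq_bigr do rewrite ip_leaf_vec; exact: (op_bessel N (fun j => ip v (e j))). Qed.

Lemma block_mean_bessel v : \sum_(j < 2 ^ r) sqmod (ip v (mean_vec j)) / 2 ^+ lam
  <= \sum_(i < 2 ^ N) sqmod (ip v (e i)).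
Proof. under eq_bigr do rewrite ip_mean; exact: (mean_square_bessel (fun j => ip v (e j))). Qed.

(** A linear functional that vanishes on all means and reads off the difference
    of two coefficients of a combination of leaves. *)
Lemma ip_sum_leaf_diff (a : nat -> K^o) i k : (i < 2 ^ N)%N -> (k < 2 ^ N)%N ->
  (i %/ 2 ^ lam = k %/ 2 ^ lam)%N ->
  ip (\sum_(i < 2 ^ N) a i *: leaf_vec i) (e i)
  - ip (\sum_(i < 2 ^ N) a i *: leaf_vec i) (e k) = a i - a k.
Proof.
move=> li lk eik; rewrite sum_leaf_vec !(ip_sumb orthonormal_e (2 ^ N) (op N a)) li lk.
apply: (dyadic_op_diff (lam := lam)) => // s lt_s.
by rewrite jump_weight /jump !tau_lam ?(ltnW lt_s) // subrr mul0r rmorph0.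
Qed.

Lemma sqnorm_sum_leaf_vec :
  sqnorm (\sum_(i < 2 ^ N) leaf_vec i) = tau N ^+ 2 * 2 ^+ N.
Proof.
rewrite sum_dyadic_op; last by rewrite /scalar_weight tau0 rmorph1.
rewrite (sqnormZ S hip) sqmod_real; congr (_ * _).
rewrite -[RHS](_ : \sum_(i < 2 ^ N) sqmod 1 = _); last first.
  by rewrite -(rmorph1 (of_real S)) sqmod_real expr1n sumr_const card_ord natrX.
rewrite -(sqnorm_sumb S hip orthonormal_e (2 ^ N) (fun=> 1)).
by under [in RHS]eq_bigr do rewrite scale1r.
Qed.

End Block.

(** * Signs and rearrangements *)

Section Rearrangements.
Variables (R : realType) (K : numFieldType) (theta : K -> K) (S : real_parts R theta).
Variables (H : completeNormedModType K) (ip : {dot H for theta}).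
Hypothesis hip : norm_from_dot ip.
Local Notation sqnorm := (sqnorm S ip).

(** The signs are chosen greedily: by the parallelogram law one of [w + u t] and
    [w - u t] has square norm at least [sqnorm w + sqnorm (u t)]. *)
Lemma exists_large_signed_sum (s : seq nat) (u : nat -> H) : exists s1 s2 : seq nat,
  perm_eq (s1 ++ s2) s /\
  \sum_(t <- s) sqnorm (u t) <= sqnorm (\sum_(t <- s1) u t - \sum_(t <- s2) u t).
Proof.
elim: s => [|t s [s1 [s2 [ps le_s]]]].
  by exists [::], [::]; rewrite !big_nil subrr (sqnorm_ge0 S hip).
set w := _ - _ in le_s; rewrite big_cons.
have := sqnorm_parallelogram S ip w (u t).
case: (lerP (sqnorm w + sqnorm (u t)) (sqnorm (w + u t))) => [ge|lt] par.
  exists (t :: s1), s2; split; first by rewrite /= perm_cons.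
  rewrite big_cons -addrA -/w [u t + w]addrC; lra.
exists s1, (t :: s2); split.
  by rewrite -(cat1s t s2) perm_catCA /= perm_cons.
rewrite big_cons opprD addrCA addrC -/w; lra.
Qed.

(** Of the terms with sign [+] and those with sign [-], one group has a sum of
    at least half the norm of the signed sum. *)
Lemma exists_large_subsum (s : seq nat) (u : nat -> H) : uniq s -> exists F : seq nat,
  [/\ uniq F, {subset F <= s} &
      \sum_(t <- s) sqnorm (u t) <= 4 * sqnorm (\sum_(t <- F) u t)].
Proof.
move=> us; have [s1 [s2 [ps le_s]]] := exists_large_signed_sum s u.
have := us; rewrite -(perm_uniq ps) cat_uniq => /and3P[us1 _ us2].
have := sqnorm_sub S hip (\sum_(t <- s1) u t) (\sum_(t <- s2) u t) => le_d.
have sub t : (t \in s) = (t \in s1) || (t \in s2) by rewrite -(perm_mem ps) mem_cat.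
case: (lerP (sqnorm (\sum_(t <- s1) u t)) (sqnorm (\sum_(t <- s2) u t))) => c.
  exists s2; split=> // [t|]; first by rewrite sub => ->; rewrite orbT.
  lra.
exists s1; split=> // [t|]; first by rewrite sub => ->.
lra.
Qed.

(** Choose consecutive intervals [O n, O n.+1[ each of which contains one of the
    given finite sets, and permute each interval so that its finite set comes
    first.  The partial sums at [O n] and
    after the finite set differ by a vector of norm at least [1]. *)
Lemma divergent_rearrangement (u : nat -> H) :
  (forall N, exists F : seq nat, [/\ uniq F, {in F, forall t, (N <= t)%N} &
      1 <= sqnorm (\sum_(t <- F) u t)]) ->
  exists p : nat -> nat, bijective p /\ ~ cvgn (series (u \o p)).
Proof.
move=> /choice[F FP].
pose nxt N := (\max_(t <- N :: F N) t).+1.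
have nxt_gt N t : t \in N :: F N -> (t < nxt N)%N.
  by move=> tF; rewrite ltnS; exact: (@leq_bigmax_seq _ _ xpredT id t tF).
pose O := fix O n := if n is m.+1 then nxt (O m) else 0%N.
have O_lt n : (O n < O n.+1)%N by apply: nxt_gt; rewrite mem_head.
pose k n := (O n.+1 - O n)%N.
have k_gt0 n : (0 < k n)%N by rewrite subn_gt0.
have offO n : offset k n = O n.
  elim: n => [|n IH]; first by rewrite /offset big_ord0.
  by rewrite offsetS IH /k subnKC // ltnW.
pose rest n := [seq t <- iota (O n) (k n) | t \notin F (O n)].
pose L n := F (O n) ++ rest n.
have memI n t : (t \in iota (O n) (k n)) = (O n <= t < O n.+1)%N.
  by rewrite mem_iota /k subnKC // ltnW.
have permL n : perm_eq (L n) (iota (O n) (k n)).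
  have [uF geF _] := FP (O n); apply: uniq_perm; rewrite ?iota_uniq //.
    rewrite cat_uniq uF filter_uniq ?iota_uniq // andbT.
    by apply/hasPn => t; rewrite mem_filter => /andP[].
  move=> t; rewrite mem_cat mem_filter.
  case: (boolP (t \in F (O n))) => //= tF; apply/esym.
  by rewrite memI geF //= nxt_gt // inE tF orbT.
have sizeL n : size (L n) = k n by rewrite (perm_size (permL n)) size_iota.
have uniqL n : uniq (L n) by rewrite (perm_uniq (permL n)) iota_uniq.
have cellL n t : t \in L n -> (cell k t).1 = n.
  rewrite (perm_mem (permL n)) memI -offO => /andP[le_t lt_t].
  rewrite -(subnKC le_t) cell_offset //.
  by rewrite /k; rewrite offO in le_t *; lia.
pose p m := nth 0%N (L (cell k m).1) (cell k m).2.
pose p' m := (O (cell k m).1 + index m (L (cell k m).1))%N.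
exists p; split.
  exists p' => m.
    have [lt_m def_m] := cellP k_gt0 m.
    have pL : p m \in L (cell k m).1 by rewrite mem_nth // sizeL.
    by rewrite /p' (cellL _ _ pL) index_uniq ?sizeL // -offO -def_m.
  have [lt_m def_m] := cellP k_gt0 m.
  have mL : m \in L (cell k m).1.
    rewrite (perm_mem (permL _)) memI -!offO offsetS.
    by move: lt_m def_m; lia.
  have lt_i : (index m (L (cell k m).1) < k (cell k m).1)%N by rewrite -sizeL index_mem.
  by rewrite /p /p' -offO cell_offset // nth_index.
move=> /(cvgn_sqnorm_cauchy S hip) /(_ 1 ltr01)[M hM].
have [uF geF leF] := FP (O M).
have le_M : (M <= O M)%N by rewrite -offO leq_offset_id.
have := hM (O M) (O M + size (F (O M)))%N le_M (leq_trans le_M (leq_addr _ _)).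
rewrite ltNge => /negP; apply.
rewrite /series /= !big_mkord big_split_ord /= addrAC subrr add0r.
have -> : \sum_(i < size (F (O M))) u (p (O M + i)%N) = \sum_(t <- F (O M)) u t => //.
rewrite (big_nth 0%N) big_mkord; apply: eq_bigr => i _; congr u.
have lt_i : (i < k M)%N.
  by rewrite -sizeL size_cat (leq_trans (ltn_ord i)) // leq_addr.
by have := cell_offset k_gt0 lt_i; rewrite offO /p => -> /=; rewrite nth_cat ltn_ord.
Qed.

End Rearrangements.

(** * The weights *)

Section FrameWeights.
Variables (R : realType) (lam : nat).

(** The ratio [9 / 10] has [(10 / 9) ^ 2 <= 5 / 4], the growth that truncation
    tolerates. *)
Definition weight s : R := (9 / 10) ^+ (s - lam).

Lemma weight_low s : (s <= lam)%N -> weight s = 1.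
Proof. by rewrite /weight -subn_eq0 => /eqP ->. Qed.

Lemma weight0 : weight 0 = 1.
Proof. exact: weight_low. Qed.

Lemma weight_gt0 s : 0 < weight s.
Proof. by rewrite exprn_gt0 // divr_gt0. Qed.

Lemma weightS s : (lam <= s)%N -> weight s.+1 = 9 / 10 * weight s.
Proof. by move=> ge; rewrite /weight subSn // exprS. Qed.

Lemma weight_dec s : weight s.+1 <= weight s.
Proof.
have [lt|ge] := ltnP s lam; first by rewrite !weight_low // ltnW.
by rewrite weightS //; have := weight_gt0 s; lra.
Qed.

Lemma weight_slow s : weight s ^+ 2 <= 5 / 4 * weight s.+1 ^+ 2.
Proof.
have [lt|ge] := ltnP s lam; first by rewrite !weight_low ?(ltnW lt) //= expr1n; lra.
by rewrite weightS // exprMn; have := sqr_ge0 (weight s); lra.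
Qed.

(** [(9 / 10) ^ 8 <= 1 / 2], so four scales halve the squared weight. *)
Lemma weight_small n : weight (4 * n + lam) ^+ 2 <= (1 / 2) ^+ n.
Proof.
rewrite /weight addnK -exprM mulnC mulnA exprM lerXn2r ?nnegrE ?exprn_ge0 ?divr_ge0 //.
by rewrite !exprSr expr0; lra.
Qed.

End FrameWeights.

(** * The frame *)

Section Global.
Variables (R : realType) (K : numFieldType) (theta : K -> K) (S : real_parts R theta).
Variables (H : completeNormedModType K) (ip : {dot H for theta}).
Hypothesis hip : norm_from_dot ip.
Variable b : nat -> H.
Hypothesis orthonormal_b : forall i j, ip (b i) (b j) = (i == j)%:R.
Hypothesis complete_b : forall v, (fun n => proj ip b n v) @ \oo --> v.
Local Notation sqnorm := (sqnorm S ip).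
Local Notation sqmod := (sqmod S).

(** Block [n] has weights [1] up to the scale [n.+1], and [4 * n] further
    scales.  Both numbers have to tend to infinity: the first one makes a missing
    leaf expensive, the second one makes the leaves ill-conditioned. *)
Definition leaves n := (2 ^ (4 * n + n.+1))%N.
Definition means n := (2 ^ (4 * n))%N.

Lemma leaves_gt0 n : (0 < leaves n)%N. Proof. by rewrite expn_gt0. Qed.
Lemma means_gt0 n : (0 < means n)%N. Proof. by rewrite expn_gt0. Qed.

Definition block_basis n i := b (offset leaves n + i).
Definition leaf n i := leaf_vec S (@weight R n.+1) n.+1 (4 * n) (block_basis n) i.
Definition mean n j := mean_vec n.+1 (block_basis n) j.
Definition normalize (v : H) := `|v|^-1 *: v.
Definition leaf_at m := leaf (cell leaves m).1 (cell leaves m).2.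
Definition mean_at m := mean (cell means m).1 (cell means m).2.
(** Leaves and means alternate, so that the leaves are the subsequence of even
    indices. *)
Definition frame_vec m :=
  if odd m then normalize (mean_at m./2) else normalize (leaf_at m./2).
Definition block_of m :=
  if odd m then (cell means m./2).1 else (cell leaves m./2).1.

Lemma orthonormal_block_basis n i j : ip (block_basis n i) (block_basis n j) = (i == j)%:R.
Proof. by rewrite orthonormal_b eqn_add2l. Qed.

(** Membership in the span of block [n], expressed by coordinates. *)
Definition coords_in n (v : H) := forall j, (cell leaves j).1 != n -> ip v (b j) = 0.

Lemma cell_block j :
  exists2 i, (i < leaves (cell leaves j).1)%N & b j = block_basis (cell leaves j).1 i.
Proof.
have [lt_j def_j] := cellP leaves_gt0 j.
by exists (cell leaves j).2; rewrite // /block_basis -def_j.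
Qed.

Lemma sqnorm_small (v : H) : (forall e, 0 < e -> sqnorm v < e) -> v = 0.
Proof.
move=> h; apply/eqP; rewrite -(sqnorm_eq0 S hip) eq_le (sqnorm_ge0 S hip) andbT leNgt.
by apply/negP => /h; rewrite ltxx.
Qed.

Lemma ip_ext u v : (forall j, ip u (b j) = ip v (b j)) -> u = v.
Proof.
move=> e; apply/eqP; rewrite -subr_eq0; apply/eqP/sqnorm_small => r r0.
have [N hN] := iffRL (cvg_sqnorm S hip _ _) (@complete_b (u - v)) r r0.
suff p0 : proj ip b N (u - v) = 0 by have := hN N (leqnn N); rewrite p0 subr0.
by rewrite /proj big1 // => i _; rewrite ipDl ipNl e subrr scale0r.
Qed.

Lemma coords_inD n u v : coords_in n u -> coords_in n v -> coords_in n (u + v).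
Proof. by move=> hu hv j hj; rewrite ipDl hu // hv // addr0. Qed.

Lemma coords_inZ n a v : coords_in n v -> coords_in n (a *: v).
Proof. by move=> hv j hj; rewrite ipZl hv // mulr0. Qed.

Lemma coords_in_sum n I (r : seq I) (P : pred I) (g : I -> H) :
  (forall i, P i -> coords_in n (g i)) -> coords_in n (\sum_(i <- r | P i) g i).
Proof. by move=> hg j hj; rewrite ip_suml big1 // => i Pi; apply: hg. Qed.

Lemma coords_in_basis n i : (i < leaves n)%N -> coords_in n (block_basis n i).
Proof.
move=> lt_i j hj; rewrite orthonormal_b; case: eqP => // e.
by move: hj; rewrite -e (cell_offset leaves_gt0 lt_i) eqxx.
Qed.

Lemma coords_in_expansion n v : coords_in n v ->
  v = \sum_(i < leaves n) ip v (block_basis n i) *: block_basis n i.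
Proof.
move=> hv; apply: ip_ext => j; case: (eqVneq (cell leaves j).1 n) => [e|ne].
  have [i lt_i ->] := cell_block j; rewrite e in lt_i *.
  by rewrite (ip_sumb (orthonormal_block_basis n) _ (fun i => ip v (block_basis n i))) lt_i.
by rewrite hv // ip_suml big1 // => i _; rewrite ipZl coords_in_basis ?mulr0.
Qed.

Lemma coords_in_orth n p u v : n != p -> coords_in n u -> coords_in p v -> ip u v = 0.
Proof.
move=> ne hu hv; rewrite (coords_in_expansion hv) ip_sumr big1 // => i _.
by rewrite ipZr hu ?mulr0 // (cell_offset leaves_gt0 (ltn_ord i)) eq_sym.
Qed.

Lemma coords_in_eq n u v : coords_in n u -> coords_in n v ->
  (forall i, (i < leaves n)%N -> ip u (block_basis n i) = ip v (block_basis n i)) -> u = v.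
Proof.
move=> hu hv e; rewrite (coords_in_expansion hu) (coords_in_expansion hv).
by apply: eq_bigr => i _; rewrite e.
Qed.

Lemma coords_in_leaf n i : (i < leaves n)%N -> coords_in n (leaf n i).
Proof.
move=> lt_i; rewrite /leaf leaf_vec_delta //.
by apply: coords_in_sum => j _; apply: coords_inZ; apply: coords_in_basis.
Qed.

Lemma coords_in_mean n j : (j < means n)%N -> coords_in n (mean n j).
Proof.
move=> lt_j; apply: coords_in_sum => i _; apply: coords_in_basis.
have := ltn_ord i; rewrite /leaves expnD -/(means n) => lt_i.
apply: (@leq_trans (j.+1 * 2 ^ n.+1)); first by rewrite mulSn addnC ltn_add2r.
by rewrite leq_mul2r lt_j orbT.
Qed.

Lemma coords_in_leaf_at m : coords_in (cell leaves m).1 (leaf_at m).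
Proof. by have [lt_m _] := cellP leaves_gt0 m; apply: coords_in_leaf. Qed.

Lemma coords_in_mean_at m : coords_in (cell means m).1 (mean_at m).
Proof. by have [lt_m _] := cellP means_gt0 m; apply: coords_in_mean. Qed.

Lemma coords_in_frame m : coords_in (block_of m) (frame_vec m).
Proof.
rewrite /block_of /frame_vec; case: ifP => _; apply: coords_inZ.
  exact: coords_in_mean_at.
exact: coords_in_leaf_at.
Qed.

Lemma sqnorm_leaf n i : (i < leaves n)%N -> 1 / 4 <= sqnorm (leaf n i) <= 1.
Proof.
move=> lt_i; rewrite /leaf; apply/andP; split.
  exact: (sqnorm_leaf_ge S hip (@weight0 R n.+1) (@weight_gt0 R n.+1) (@weight_dec R n.+1)
            _ (@weight_low R n.+1) (orthonormal_block_basis n)).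
exact: (sqnorm_leaf_le1 S hip (@weight0 R n.+1) (@weight_gt0 R n.+1) (@weight_dec R n.+1)
          (orthonormal_block_basis n)).
Qed.

Lemma sqnorm_mean n j : sqnorm (mean n j) = 2 ^+ n.+1.
Proof. by apply: (sqnorm_mean_vec S hip); apply: orthonormal_block_basis. Qed.

Lemma sqnorm_leaf_at m : 1 / 4 <= sqnorm (leaf_at m) <= 1.
Proof. by have [lt_m _] := cellP leaves_gt0 m; apply: sqnorm_leaf. Qed.

Lemma leaf_at_neq0 m : leaf_at m != 0.
Proof.
rewrite -(sqnorm_eq0 S hip) gt_eqF //.
by have /andP[+ _] := sqnorm_leaf_at m; apply: lt_le_trans; lra.
Qed.

Lemma mean_at_neq0 m : mean_at m != 0.
Proof. by rewrite -(sqnorm_eq0 S hip) sqnorm_mean gt_eqF // exprn_gt0. Qed.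

Lemma norm_normalize v : v != 0 -> `|normalize v| = 1.
Proof.
by move=> v0; rewrite normrZ normfV normr_id mulVf // normr_eq0.
Qed.

Lemma norm_frame_vec m : `|frame_vec m| = 1.
Proof.
by rewrite /frame_vec; case: ifP => _; rewrite norm_normalize ?leaf_at_neq0 ?mean_at_neq0.
Qed.

Lemma sqmod_norm v : sqmod `|v| = sqnorm v.
Proof. by apply: (@of_real_inj _ _ _ S); rewrite -normr_sqmod -normr_sqnorm // normr_id. Qed.

Lemma sqmodV x : sqmod x^-1 = (sqmod x)^-1.
Proof.
case: (eqVneq x 0) => [->|x0]; first by rewrite invr0 sqmod0 invr0.
apply: (@mulfI _ (sqmod x)); first by rewrite sqmod_eq0.
rewrite -sqmodM divff // divff ?sqmod_eq0 //.
by rewrite -(rmorph1 (of_real S)) sqmod_real expr1n.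
Qed.

Lemma sqmod_ip_normalize u v : sqmod (ip u (normalize v)) = sqmod (ip u v) / sqnorm v.
Proof.
rewrite /normalize (nneg_real S (_ : 0 <= `|v|^-1)) ?invr_ge0 //.
rewrite ipZr_real sqmodM -nneg_real ?invr_ge0 // sqmodV sqmod_norm mulrC //.
Qed.

(** * The leaves form a Schauder basis *)

(** Coordinates are continuous, so a coordinate that is eventually constant
    along a sequence passes to the limit. *)
Lemma coord_lim (u : nat -> H) (v : H) (j : nat) (c : K) :
  u @ \oo --> v -> (exists M, forall n, (M <= n)%N -> ip (u n) (b j) = c) ->
  ip v (b j) = c.
Proof.
move=> /(iffRL (cvg_sqnorm S hip _ _)) lim_u [M hM]; apply/eqP.
rewrite -subr_eq0 -(sqmod_eq0 S) eq_le sqmod_ge0 andbT leNgt; apply/negP => pos.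
have [N hN] := lim_u _ pos.
have := hN _ (leq_maxl N M); rewrite ltNge => /negP; apply.
rewrite -(hM _ (leq_maxr N M)) -ipNl -ipDl.
exact: (sqmod_ip hip _ (sqnorm_b S orthonormal_b j)).
Qed.

Local Notation op n := (dyadic_op (scalar_weight S (@weight R n.+1)) (4 * n + n.+1)).

Lemma sum_leaf n (a : nat -> K^o) :
  \sum_(i < leaves n) a i *: leaf n i = \sum_(i < leaves n) (op n a i : K) *: block_basis n i.
Proof. exact: sum_leaf_vec. Qed.

Lemma leaf_at_offset n i : (i < leaves n)%N -> leaf_at (offset leaves n + i) = leaf n i.
Proof. by move=> lt_i; rewrite /leaf_at (cell_offset leaves_gt0 lt_i). Qed.

Lemma mean_at_offset n i : (i < means n)%N -> mean_at (offset means n + i) = mean n i.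
Proof. by move=> lt_i; rewrite /mean_at (cell_offset means_gt0 lt_i). Qed.

Lemma ip_series_leaf (d : nat -> K) n i M : (i < leaves n)%N -> (offset leaves n.+1 <= M)%N ->
  ip (series (fun m => d m *: leaf_at m) M) (block_basis n i)
  = op n (fun i => d (offset leaves n + i)%N) i.
Proof.
move=> lt_i le_M; rewrite /series /= big_mkord -(subnKC le_M) big_split_ord /= ipDl.
rewrite (sum_offset leaves (fun m => d m *: leaf_at m)) big_ord_recr /= ipDl.
rewrite ip_suml big1 => [|p _]; last first.
  rewrite ip_suml big1 // => k _; rewrite ipZl leaf_at_offset // coords_in_leaf ?mulr0 //.
  by rewrite (cell_offset leaves_gt0 lt_i) /= gtn_eqF.
rewrite add0r [X in _ + X](_ : _ = 0) ?addr0; last first.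
  rewrite ip_suml big1 // => p _; rewrite ipZl coords_in_leaf_at ?mulr0 //.
  rewrite (cell_offset leaves_gt0 lt_i) /= ltn_eqF //.
  by rewrite ltnNge -ltnS -(lt_offset leaves_gt0) -leqNgt leq_addr.
under eq_bigr do rewrite leaf_at_offset //.
rewrite (sum_leaf n (fun i => d (offset leaves n + i)%N)).
by rewrite (ip_sumb (orthonormal_block_basis n) _ (op n (fun i => d (offset leaves n + i)%N))) lt_i.
Qed.

(** The coordinates of the partial sums in block [n] are constant once the
    block is complete, so they are zero; the multiplier is injective. *)
Lemma leaf_series_unique (d : nat -> K) :
  series (fun m => d m *: leaf_at m) @ \oo --> (0 : H) -> forall m, d m = 0.
Proof.
move=> lim0 m; have [lt_m def_m] := cellP leaves_gt0 m; rewrite def_m.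
apply: (op_inj (S := S) (@weight0 R (cell leaves m).1.+1) (@weight_gt0 R _)
   (a := fun i => d (offset leaves (cell leaves m).1 + i)%N) _ lt_m) => i lt_i.
rewrite -(ip0l ip (block_basis (cell leaves m).1 i)); apply/esym/(coord_lim lim0).
exists (offset leaves (cell leaves m).1.+1) => M; exact: ip_series_leaf.
Qed.

Lemma proj_offset n v : proj ip b (offset leaves n) v
  = \sum_(p < n) \sum_(i < leaves p) ip v (block_basis p i) *: block_basis p i.
Proof. exact: (sum_offset leaves (fun j => ip v (b j) *: b j)). Qed.

(** Inverting the multiplier in each block gives the coefficients, and at the ends
    of blocks the partial sums are those of the orthonormal expansion.  Inside
    a block the partial sum deviates by a truncated sum of leaves, whose norm is
    at most [6] times that of the part of [v] in the block. *)
Lemma leaf_series_exists (v : H) : exists a : nat -> K,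
  series (fun m => a m *: leaf_at m) @ \oo --> v.
Proof.
have /choice[A hA] : forall n, exists a : nat -> K^o, forall i, (i < leaves n)%N ->
    op n a i = ip v (block_basis n i).
  move=> n; have [a ha] := op_surj S (@weight0 R n.+1) (@weight_gt0 R n.+1) (4 * n + n.+1)
    (fun i => ip v (block_basis n i) : K^o).
  by exists a.
pose a m := A (cell leaves m).1 (cell leaves m).2; exists a.
have sumA n : \sum_(i < leaves n) A n i *: leaf n i
    = \sum_(i < leaves n) ip v (block_basis n i) *: block_basis n i.
  by rewrite sum_leaf; apply: eq_bigr => i _; rewrite hA.
have sum_a n : \sum_(m < offset leaves n) a m *: leaf_at m = proj ip b (offset leaves n) v.
  rewrite (sum_offset leaves (fun m => a m *: leaf_at m)) proj_offset; apply: eq_bigr => p _.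
  rewrite -sumA; apply: eq_bigr => i _.
  by rewrite leaf_at_offset // /a (cell_offset leaves_gt0 (ltn_ord i)).
apply: (iffLR (cvg_sqnorm S hip _ _)) => e e0.
(* If both projections are within [e / 300] of [v], then [sqnorm T] is at most
   [36 * 4 * e / 300], and [2 * (1 + 36 * 4) = 290 < 300]. *)
have e1 : 0 < e / 300 by lra.
have [M hM] := iffRL (cvg_sqnorm S hip _ _) (@complete_b v) _ e1.
exists (offset leaves M) => m le_m.
have [lt_m def_m] := cellP leaves_gt0 m.
set n := (cell leaves m).1 in lt_m def_m; set k := (cell leaves m).2 in lt_m def_m.
have le_n : (M <= n)%N.
  by rewrite leqNgt /n -(lt_offset leaves_gt0) -leqNgt.
have big_off p : (M <= p)%N -> (M <= offset leaves p)%N.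
  by move=> le_p; apply: leq_trans le_p _; apply: leq_offset_id; apply: leaves_gt0.
have h1 := hM _ (big_off _ le_n); have h2 := hM _ (big_off _ (leqW le_n)).
pose T := \sum_(i < k) A n i *: leaf n i.
have -> : series (fun m => a m *: leaf_at m) m = proj ip b (offset leaves n) v + T.
  rewrite /series /= big_mkord def_m big_split_ord /= sum_a; congr (_ + _).
  apply: eq_bigr => i _; have lt_i : (i < leaves n)%N by apply: ltn_trans lt_m.
  by rewrite leaf_at_offset // /a (cell_offset leaves_gt0 lt_i).
have T_le : sqnorm T <= 36 * sqnorm (\sum_(i < leaves n) A n i *: leaf n i).
  apply: (sqnorm_leaf_truncate S hip (@weight0 R n.+1) (@weight_gt0 R _) (@weight_dec R _)
            (@weight_slow R _)
            (orthonormal_block_basis n) (A n)); exact: ltnW.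
have D : \sum_(i < leaves n) A n i *: leaf n i =
   (v - proj ip b (offset leaves n) v) - (v - proj ip b (offset leaves n.+1) v).
  rewrite opprB addrC addrA subrK sumA !proj_offset big_ord_recr /= addrC addKr //.
rewrite D in T_le.
have := sqnorm_sub S hip (v - proj ip b (offset leaves n) v) (v - proj ip b (offset leaves n.+1) v).
have := sqnorm_sub S hip (v - proj ip b (offset leaves n) v) T.
rewrite -[v - _ - T]addrA -opprD.
lra.
Qed.

Lemma schauder_leaf : schauder_basis leaf_at.
Proof.
move=> v; have [a ha] := leaf_series_exists v; exists a; split=> // a' ha'.
apply: funext => m; apply/eqP; rewrite -subr_eq0; apply/eqP.
apply: (leaf_series_unique (d := fun m => a m - a' m)).
have -> : series (fun m => (a m - a' m) *: leaf_at m)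
    = series (fun m => a m *: leaf_at m) - series (fun m => a' m *: leaf_at m).
  apply: funext => n; rewrite /series /= !fctE -sumrB; apply: eq_bigr => k _.
  by rewrite scalerBl.
by rewrite -(subrr v); apply: cvgB.
Qed.

Lemma schauder_basisZ (g : nat -> H) (c : nat -> K) : (forall m, c m != 0) ->
  schauder_basis g -> schauder_basis (fun m => c m *: g m).
Proof.
move=> c0 hg v; have [a [ha ua]] := hg v.
exists (fun m => a m / c m); split.
  suff -> : (fun m => (a m / c m) *: (c m *: g m)) = (fun m => a m *: g m) by [].
  by apply: funext => m; rewrite scalerA divfK.
move=> a' ha'; apply: funext => m; rewrite (ua (fun m => a' m * c m)) ?mulfK //.
suff -> : (fun m => (a' m * c m) *: g m) = (fun m => a' m *: (c m *: g m)) by [].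
by apply: funext => k; rewrite scalerA.
Qed.

Lemma schauder_frame_vec : schauder_basis (frame_vec \o double).
Proof.
have -> : frame_vec \o double = (fun m => `|leaf_at m|^-1 *: leaf_at m).
  by apply: funext => m; rewrite /frame_vec /= odd_double doubleK.
apply: schauder_basisZ schauder_leaf => m.
by rewrite invr_eq0 normr_eq0 leaf_at_neq0.
Qed.

(** * Frame bounds *)

Lemma ler_sum_widen (g : nat -> R) n p : (forall m, 0 <= g m) -> (n <= p)%N ->
  \sum_(m < n) g m <= \sum_(m < p) g m.
Proof.
move=> g0 le_np; rewrite -(subnKC le_np) big_split_ord /= lerDl.
exact: sumr_ge0.
Qed.

Lemma sum_even_odd (g : nat -> R) n :
  \sum_(m < n.*2) g m = \sum_(m < n) g m.*2 + \sum_(m < n) g m.*2.+1.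
Proof.
elim: n => [|n IH]; first by rewrite !big_ord0 addr0.
by rewrite doubleS !big_ord_recr /= IH -addrA addrACA.
Qed.

Lemma normr_of_real (r : R) : `|of_real S r| = of_real S `|r|.
Proof.
case: (lerP 0 r) => [r0|r0].
  by rewrite (ger0_norm r0) ger0_norm // of_real_ge0.
have le0 : of_real S r <= 0 by rewrite -oppr_ge0 -rmorphN of_real_ge0 oppr_ge0 ltW.
by rewrite (ler0_norm le0) (ltr0_norm r0) rmorphN.
Qed.

Lemma cvg_of_real (u : nat -> R) (l : R) : u @ \oo --> l ->
  (fun n => of_real S (u n)) @ \oo --> of_real S l.
Proof.
move=> /cvgrPdist_lt h; apply/cvgrPdist_lt => e e0.
have ee := nneg_real S (ltW e0); rewrite ee of_real_gt0 in e0.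
have [N _ hN] := h _ e0; exists N => // n /= /hN /=.
by rewrite -rmorphB normr_of_real -(ltr_of_real S) -ee.
Qed.

Lemma even_energy v n :
  \sum_(m < n) sqmod (ip v (frame_vec m.*2))
  = \sum_(m < n) sqmod (ip v (leaf_at m)) / sqnorm (leaf_at m).
Proof.
apply: eq_bigr => m _.
by rewrite /frame_vec odd_double doubleK sqmod_ip_normalize.
Qed.

Lemma odd_energy v n :
  \sum_(m < n) sqmod (ip v (frame_vec m.*2.+1))
  = \sum_(m < n) sqmod (ip v (mean_at m)) / sqnorm (mean_at m).
Proof.
apply: eq_bigr => m _.
by rewrite /frame_vec /= odd_double /= uphalf_double sqmod_ip_normalize.
Qed.

Lemma mean_energy_offset v n :
  \sum_(m < offset means n) sqmod (ip v (mean_at m)) / sqnorm (mean_at m)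
  = \sum_(p < n) \sum_(j < means p) sqmod (ip v (mean p j)) / 2 ^+ p.+1.
Proof.
rewrite (sum_offset means (fun m => sqmod (ip v (mean_at m)) / sqnorm (mean_at m))).
apply: eq_bigr => p _; apply: eq_bigr => j _.
by rewrite mean_at_offset // sqnorm_mean.
Qed.

Lemma coords_energy_offset v n :
  \sum_(j < offset leaves n) sqmod (ip v (b j))
  = \sum_(p < n) \sum_(i < leaves p) sqmod (ip v (block_basis p i)).
Proof. exact: (sum_offset leaves (fun j => sqmod (ip v (b j)))). Qed.

Lemma leaf_energy_offset v n :
  \sum_(m < offset leaves n) sqmod (ip v (leaf_at m))
  = \sum_(p < n) \sum_(i < leaves p) sqmod (ip v (leaf p i)).
Proof.
rewrite (sum_offset leaves (fun m => sqmod (ip v (leaf_at m)))).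
by apply: eq_bigr => p _; apply: eq_bigr => j _; rewrite leaf_at_offset.
Qed.

Definition energy v n := \sum_(m < n) sqmod (ip v (frame_vec m)).

(** The leaves have square norm at least [1 / 4] before normalization, whence
    the contribution [4]; the means contribute [1]. *)
Lemma energy_le v n : energy v n <= 5 * sqnorm v.
Proof.
have id_le k : (forall p, 0 < k p)%N -> (n <= offset k n)%N by move=> k0; apply: leq_offset_id.
have le_n2 : (n <= n.*2)%N by rewrite -addnn leq_addr.
apply: le_trans (ler_sum_widen (g := fun m => sqmod (ip v (frame_vec m))) _ le_n2) _.
  by move=> m; apply: sqmod_ge0.
rewrite (sum_even_odd (fun m => sqmod (ip v (frame_vec m)))) even_energy odd_energy.
have := bessel S hip orthonormal_b (offset leaves n) v; rewrite coords_energy_offset => le_b.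
have le1 : \sum_(m < n) sqmod (ip v (leaf_at m)) / sqnorm (leaf_at m) <= 4 * sqnorm v.
  apply: (@le_trans _ _ (4 * \sum_(m < n) sqmod (ip v (leaf_at m)))).
    rewrite mulr_sumr; apply: ler_sum => m _; rewrite mulrC.
    have /andP[ge _] := sqnorm_leaf_at m.
    rewrite ler_wpM2r ?sqmod_ge0 // -[leRHS]invrK lef_pV2 ?posrE ?invr_gt0 //.
      by move: ge; rewrite div1r.
    by apply: lt_le_trans ge; lra.
  rewrite ler_wpM2l //; apply: le_trans le_b.
  apply: le_trans (ler_sum_widen (g := fun m => sqmod (ip v (leaf_at m))) _
                     (id_le _ leaves_gt0)) _.
    by move=> m; apply: sqmod_ge0.
  rewrite leaf_energy_offset; apply: ler_sum => p _; 
  exact: (block_leaf_bessel S ip (@weight0 R p.+1) (@weight_gt0 R p.+1) (@weight_dec R p.+1)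
           p.+1 (4 * p)).
have le2 : \sum_(m < n) sqmod (ip v (mean_at m)) / sqnorm (mean_at m) <= sqnorm v.
  apply: le_trans le_b.
  apply: le_trans (ler_sum_widen (g := fun m => sqmod (ip v (mean_at m)) / sqnorm (mean_at m))
                     _ (id_le _ means_gt0)) _.
    by move=> m; rewrite divr_ge0 ?sqmod_ge0 ?(sqnorm_ge0 S hip).
  rewrite mean_energy_offset; apply: ler_sum => p _.
  exact: (block_mean_bessel S ip p.+1 (4 * p)).
lra.
Qed.

Lemma energy_ge v (e : R) : 0 < e -> exists n, sqnorm v - e <= energy v n.
Proof.
move=> e0; have [n hn] := iffRL (cvg_sqnorm S hip _ _) (@complete_b v) _ e0.
pose M := maxn (offset leaves n) (offset means n); exists M.*2.
rewrite /energy (sum_even_odd (fun m => sqmod (ip v (frame_vec m)))) even_energy odd_energy.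
have le_n : (n <= offset leaves n)%N by apply: leq_offset_id; apply: leaves_gt0.
have := hn _ le_n; have := bessel_eq S hip orthonormal_b (offset leaves n) v.
rewrite coords_energy_offset.
have le1 : \sum_(p < n) \sum_(i < leaves p) sqmod (ip v (leaf p i)) <=
    \sum_(m < M) sqmod (ip v (leaf_at m)) / sqnorm (leaf_at m).
  rewrite -leaf_energy_offset.
  apply: le_trans (ler_sum_widen (g := fun m => sqmod (ip v (leaf_at m))) _
                     (leq_maxl _ (offset means n))) _.
    by move=> m; apply: sqmod_ge0.
  apply: ler_sum => m _; have /andP[ge le] := sqnorm_leaf_at m.
  rewrite ler_peMr ?sqmod_ge0 // invf_ge1 //.
  by apply: lt_le_trans ge; lra.
have le2 : \sum_(p < n) \sum_(j < means p) sqmod (ip v (mean p j)) / 2 ^+ p.+1 <=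
    \sum_(m < M) sqmod (ip v (mean_at m)) / sqnorm (mean_at m).
  rewrite -mean_energy_offset; 
  apply: (ler_sum_widen (g := fun m => sqmod (ip v (mean_at m)) / sqnorm (mean_at m)))
    (leq_maxr _ _) => m.
  by rewrite divr_ge0 ?sqmod_ge0 ?(sqnorm_ge0 S hip).
have le3 : \sum_(p < n) \sum_(i < leaves p) sqmod (ip v (block_basis p i)) <=
   \sum_(p < n) \sum_(i < leaves p) sqmod (ip v (leaf p i)) +
   \sum_(p < n) \sum_(j < means p) sqmod (ip v (mean p j)) / 2 ^+ p.+1.
  rewrite -big_split; apply: ler_sum => p _.
  exact: (block_frame_lower S ip (@weight0 R p.+1) (4 * p) (@weight_low R p.+1)).
lra.
Qed.

Lemma frame_frame_vec : is_frame ip frame_vec.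
Proof.
exists 1, (of_real S 5); split=> //.
  by rewrite -(rmorph1 (of_real S)) ler_of_real; lra.
move=> v T.
have TE : T = (fun n => of_real S (energy v n)).
  apply: funext => n; rewrite /T /series /= big_mkord rmorph_sum.
  by apply: eq_bigr => m _; rewrite (normr_sqmod S).
have nd : {homo energy v : n p / (n <= p)%N >-> n <= p}.
  move=> n p; apply: (ler_sum_widen (g := fun m => sqmod (ip v (frame_vec m)))) => m.
  exact: sqmod_ge0.
have ub : has_ubound (range (energy v)).
  by exists (5 * sqnorm v) => _ [n _ <-]; apply: energy_le.
have cv := nondecreasing_cvgn nd ub.
set l := sup _ in cv.
have cvT := cvg_of_real cv; rewrite -TE in cvT.
split; first by apply/cvg_ex; exists (of_real S l).
have -> : limn T = of_real S l by apply: cvg_lim.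
rewrite (normr_sqnorm S hip) mul1r -rmorphM !ler_of_real; apply/andP; split.
  apply/ler_addgt0Pr => e e0; have [n hn] := energy_ge v e0.
  have le_l : energy v n <= l by apply: ub_le_sup => //; exists n.
  lra.
by apply: ge_sup; [exists (energy v 0); exists 0%N | move=> _ [n _ <-]; apply: energy_le].
Qed.

(** * Combinations with large coefficients and small norm *)

Lemma ler_sum_subseq (g : nat -> R) (F s : seq nat) : (forall m, 0 <= g m) ->
  uniq F -> uniq s -> {subset F <= s} -> \sum_(m <- F) g m <= \sum_(m <- s) g m.
Proof.
move=> g0 uF us Fs; rewrite [leRHS](bigID (fun m => m \in F)) /= -[X in _ <= X + _]big_filter.
have pF : perm_eq [seq m <- s | m \in F] F.
  apply: uniq_perm => //; first exact: filter_uniq.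
  by move=> m; rewrite mem_filter; case: (boolP (m \in F)) => //= /Fs ->.
by rewrite (perm_big _ pF) lerDl sumr_ge0.
Qed.

Definition leaf_index n i := (offset leaves n + i).*2.

Lemma leaf_index_inj n : injective (leaf_index n).
Proof. by move=> i k /double_inj /addnI. Qed.

Lemma frame_leaf_index n i : (i < leaves n)%N ->
  frame_vec (leaf_index n i) = normalize (leaf n i).
Proof.
by move=> lt_i; rewrite /frame_vec /leaf_index odd_double doubleK leaf_at_offset.
Qed.

Lemma block_of_leaf_index n i : (i < leaves n)%N -> block_of (leaf_index n i) = n.
Proof.
by move=> lt_i; rewrite /block_of /leaf_index odd_double doubleK (cell_offset leaves_gt0 lt_i).
Qed.

Section Difference.
Variables n i k : nat.
Hypotheses (lt_i : (i < leaves n)%N) (lt_k : (k < leaves n)%N).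
Hypothesis same_ik : (i %/ 2 ^ n.+1 = k %/ 2 ^ n.+1)%N.

(** The functional that vanishes on the means of block [n] and compares the
    coefficients of two leaves in the same interval of length [2 ^ n.+1]. *)
Definition coord_gap (v : H) := ip v (block_basis n i) - ip v (block_basis n k).

Lemma coord_gapB u v : coord_gap (u - v) = coord_gap u - coord_gap v.
Proof. by rewrite /coord_gap !ipDl !ipNl opprD addrACA -opprD. Qed.

Lemma coord_gapZ a v : coord_gap (a *: v) = a * coord_gap v.
Proof. by rewrite /coord_gap !ipZl mulrBr. Qed.

Lemma coord_gap_sum (s : seq nat) (g : nat -> H) :
  coord_gap (\sum_(m <- s) g m) = \sum_(m <- s) coord_gap (g m).
Proof. by rewrite /coord_gap !ip_suml -sumrB. Qed.

Lemma coord_gap_leaf j : (j < leaves n)%N -> coord_gap (leaf n j) = (i == j)%:R - (k == j)%:R.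
Proof.
move=> lt_j; rewrite -(ip_sum_leaf_diff S (@weight_low R n.+1) (orthonormal_block_basis n)
  (fun l => (l == j)%:R) lt_i lt_k same_ik) /coord_gap.
have -> // : leaf n j = \sum_(l < leaves n) (l == j :> nat)%:R *: leaf n l.
rewrite (bigD1 (Ordinal lt_j)) //= eqxx scale1r big1 ?addr0 // => l.
by rewrite -val_eqE /= => /negPf ->; rewrite scale0r.
Qed.

Lemma coord_gap_mean j : coord_gap (mean n j) = 0.
Proof. by rewrite /coord_gap !(ip_mean_vec _ (orthonormal_block_basis n)) same_ik subrr. Qed.

Lemma coord_gap_frame m : block_of m = n -> coord_gap (frame_vec m)
  = if odd m then 0 else `|leaf_at m./2|^-1 * ((m == leaf_index n i)%:R - (m == leaf_index n k)%:R).
Proof.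
rewrite /block_of /frame_vec; case: ifP => odd_m def_n; rewrite coord_gapZ.
  by rewrite /mean_at def_n coord_gap_mean mulr0.
have [lt_m def_m] := cellP leaves_gt0 m./2; rewrite def_n in lt_m def_m.
rewrite {2}/leaf_at def_n coord_gap_leaf //; congr (_ * _).
have e j : (m == leaf_index n j) = (j == (cell leaves m./2).2).
  rewrite -[m]odd_double_half odd_m add0n /leaf_index {1}def_m.
  by rewrite (inj_eq double_inj) eqn_add2l eq_sym doubleK.
by rewrite !e.
Qed.

(** The functional [coord_gap] equals [1] on the leaf [i] and, up to
    normalization, minus the coefficient of the leaf [k] on a combination without
    the leaf [i].  If the combination is close to the leaf [i], then this
    coefficient cannot be small. *)
Lemma coef_large (s : seq nat) (a : nat -> K) : uniq s ->
  (forall m, m \in s -> block_of m = n) -> leaf_index n i \notin s -> i != k ->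
  sqnorm (leaf n i - \sum_(m <- s) a m *: frame_vec m) <= 1 / 16 ->
  leaf_index n k \in s /\ 1 / 16 <= sqmod (a (leaf_index n k)).
Proof.
move=> us bs is_ ne_ik close; set y := \sum_(m <- s) _ in close.
set t := if leaf_index n k \in s then a (leaf_index n k) * `|leaf n k|^-1 else 0.
have dy : coord_gap y = - t.
  have term m : m \in s -> coord_gap (a m *: frame_vec m)
      = - (a m * `|leaf_at m./2|^-1 * (m == leaf_index n k)%:R).
    move=> ms; rewrite coord_gapZ coord_gap_frame ?bs //.
    have -> : (m == leaf_index n i) = false.
      by apply/eqP => e; rewrite -e ms in is_.
    case: ifP => [odd_m|_]; last by rewrite sub0r !mulrN mulrA.
    have -> : (m == leaf_index n k) = false.
      by apply/eqP => e; rewrite e odd_double in odd_m.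
    by rewrite !mulr0 oppr0.
  rewrite /y coord_gap_sum big_seq (eq_bigr _ term) -big_seq sumrN; congr (- _).
  rewrite /t; case: ifP => [ks|ks].
    rewrite (bigD1_seq (leaf_index n k)) //= eqxx mulr1 big1 ?addr0 => [|m /negPf->]; last first.
      by rewrite mulr0.
    by rewrite doubleK leaf_at_offset.
  rewrite big1_seq // => m /andP[_ ms]; case: eqP => [e|]; rewrite ?mulr0 //.
  by rewrite e ks in ms.
have dl : coord_gap (leaf n i - y) = 1 + t.
  by rewrite coord_gapB coord_gap_leaf // dy opprK eqxx eq_sym (negPf ne_ik) subr0.
have le_t : sqmod (1 + t) <= 1 / 4.
  rewrite -dl; apply: le_trans (sqmod_sub S _ _) _.
  have h1 := sqmod_ip hip (leaf n i - y) (sqnorm_b S (orthonormal_block_basis n) i).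
  have h2 := sqmod_ip hip (leaf n i - y) (sqnorm_b S (orthonormal_block_basis n) k).
  move: h1 h2 close; lra.
have ge_t : 1 / 4 <= sqmod t.
  have := sqmod_sub S (1 + t) t; rewrite addrK.
  by rewrite -[X in sqmod X](rmorph1 (of_real S)) sqmod_real expr1n; lra.
move: ge_t; rewrite /t; case: ifP => [ks|_]; last by rewrite sqmod0; lra.
rewrite sqmodM sqmodV sqmod_norm => ge_t; split=> //.
have /andP[ge le] := sqnorm_leaf lt_k.
have pos : 0 < sqnorm (leaf n k) by apply: lt_le_trans ge; lra.
rewrite ler_pdivlMr // in ge_t.
by apply: le_trans ge_t; lra.
Qed.

End Difference.

(** If all leaves of the block are present, then undo their normalization and add
    them up: the sum is the smallest weight times the sum of the basis vectors.
    If the leaf [i] is missing, approximate it by a combination of the subfamily.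
    Dropping the vectors of the other blocks improves the approximation, and
    [2 ^ n.+1 - 1] coefficients of the rest are bounded below, while the norm of
    the combination stays bounded. *)
Lemma block_small_combination (J : set nat) n :
  closure (linear_span J frame_vec) = setT ->
  exists (s : seq nat) (a : nat -> K),
  [/\ uniq s, forall m, m \in s -> J m /\ block_of m = n,
      0 < \sum_(m <- s) sqmod (a m) &
      sqnorm (\sum_(m <- s) a m *: frame_vec m)
        <= 64 * (1 / 2) ^+ n * \sum_(m <- s) sqmod (a m)].
Proof.
move=> clJ.
case: (pselect (forall i, (i < leaves n)%N -> J (leaf_index n i))) => [allJ|].
  pose s := [seq leaf_index n i | i <- iota 0 (leaves n)].
  have sum_s (W : nmodType) (g : nat -> W) :
      \sum_(m <- s) g m = \sum_(i < leaves n) g (leaf_index n i).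
    by rewrite big_map -[X in iota _ X]subn0 -/(index_iota 0 _) big_mkord.
  exists s, (fun m => `|leaf_at m./2|).
  have sum1 : \sum_(m <- s) sqmod `|leaf_at m./2| = \sum_(i < leaves n) sqnorm (leaf n i).
    rewrite sum_s; apply: eq_bigr => i _.
    by rewrite /leaf_index doubleK leaf_at_offset // sqmod_norm.
  have sum2 : \sum_(m <- s) `|leaf_at m./2| *: frame_vec m = \sum_(i < leaves n) leaf n i.
    rewrite sum_s; apply: eq_bigr => i _.
    rewrite frame_leaf_index // /leaf_index doubleK leaf_at_offset // /normalize scalerA.
    rewrite divff ?scale1r // normr_eq0 -(sqnorm_eq0 S hip) gt_eqF //.
    by have /andP[ge _] := sqnorm_leaf (ltn_ord i); apply: lt_le_trans ge; lra.
  have ge_sum : 2 ^+ (4 * n + n.+1) / 4 <= \sum_(i < leaves n) sqnorm (leaf n i).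
    apply: (@le_trans _ _ (\sum_(i < leaves n) (1 / 4 : R))).
      rewrite sumr_const card_ord -(mulr_natr (1 / 4) (leaves n)) /leaves natrX.
      by set p := 2 ^+ _; lra.
    by apply: ler_sum => i _; have /andP[] := sqnorm_leaf (ltn_ord i).
  have P : (0 : R) < 2 ^+ (4 * n + n.+1) by rewrite exprn_gt0.
  split.
  - by rewrite map_inj_uniq ?iota_uniq //; apply: leaf_index_inj.
  - move=> m /mapP[k]; rewrite mem_iota /= add0n => lt_i ->.
    by split; [apply: allJ | apply: block_of_leaf_index].
  - by rewrite sum1; apply: lt_le_trans ge_sum; rewrite divr_gt0.
  rewrite sum1 sum2 (sqnorm_sum_leaf_vec S hip (@weight0 R n.+1) _ _ (orthonormal_block_basis n)).
  have h := weight_small R n.+1 n.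
  have p2 : (0 : R) < (1 / 2) ^+ n by rewrite exprn_gt0 // divr_gt0.
  apply: (@le_trans _ _ ((1 / 2) ^+ n * 2 ^+ (4 * n + n.+1))).
    apply: ler_wpM2r; first exact: ltW.
    exact: h.
  rewrite [64 * _]mulrC -mulrA; apply: ler_wpM2l; first exact: ltW.
  move: ge_sum P; set p := 2 ^+ _; lra.
move=> /existsNP [i /not_implyP[lt_i notJ]].
have : closure (linear_span J frame_vec) (leaf n i) by rewrite clJ.
have r0 : 0 < of_real S (1 / 4) by rewrite of_real_gt0 divr_gt0.
move=> /(_ _ (nbhsx_ballx _ _ r0))[y [[A [a [AJ def_y]]] y_close]].
pose s := [seq m <- enum_fset A | block_of m == n]; exists s, a.
have us : uniq s by rewrite filter_uniq // fset_uniq.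
have sJ m : m \in s -> J m /\ block_of m = n.
  by rewrite mem_filter => /andP[/eqP bm mA]; split=> //; apply: AJ.
have {}y_close : sqnorm (leaf n i - y) < 1 / 16.
  move: y_close; rewrite -ball_normE /ball_ /= => lt.
  rewrite -(ltr_of_real S) -(normr_sqnorm S hip).
  have -> : 1 / 16 = (1 / 4 : R) ^+ 2 by lra.
  by rewrite rmorphXn /= ltr_pXn2r // nnegrE // ltW.
set ys := \sum_(m <- s) a m *: frame_vec m.
have ys_close : sqnorm (leaf n i - ys) <= 1 / 16.
  apply: le_trans (ltW y_close).
  pose z := \sum_(m <- enum_fset A | block_of m != n) a m *: frame_vec m.
  have -> : leaf n i - y = (leaf n i - ys) + (- z).
    rewrite -addrA -opprD def_y (bigID (fun m => block_of m == n)) /= /ys /s big_filter //.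
  suff orth : ip (leaf n i - ys) (- z) = 0.
    by rewrite (pythagoras S orth) lerDl (sqnorm_ge0 S hip).
  rewrite ipNr ip_sumr big1 ?oppr0 // => m ne_m.
  rewrite ipZr (@coords_in_orth n (block_of m)) ?mulr0 //.
  - by rewrite eq_sym.
  - apply: coords_inD; first exact: coords_in_leaf.
    rewrite -scaleN1r; apply: coords_inZ; rewrite /ys big_seq.
    apply: coords_in_sum => p /sJ[_ <-]; apply: coords_inZ; exact: coords_in_frame.
  - exact: coords_in_frame.
have is_ : leaf_index n i \notin s by apply/negP => /sJ[/notJ].
(* [ks] is the interval of length [D] that contains [i]; the coefficients of all
   its leaves except [i] are large. *)
pose D := (2 ^ n.+1)%N; have D0 : (0 < D)%N by rewrite expn_gt0.
pose ks := [seq (i %/ D * D + l)%N | l <- iota 0 D].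
have uks : uniq ks by rewrite map_inj_uniq ?iota_uniq //; apply: addnI.
have iks : i \in ks.
  by rewrite {1}(divn_eq i D); apply: map_f; rewrite mem_iota /= ltn_pmod.
have ksP k : k \in ks -> (k < leaves n)%N /\ (i %/ D = k %/ D)%N.
  move=> /mapP[l]; rewrite mem_iota /= add0n => lt_l ->; split.
    rewrite /leaves expnD -/D; apply: (@leq_trans ((i %/ D).+1 * D)).
      by rewrite mulSn addnC ltn_add2r.
    by rewrite leq_mul2r ltn_divLR // orbC -expnD -/(leaves n) lt_i.
  by rewrite divnMDl // (divn_small lt_l) addn0.
pose F := [seq leaf_index n k | k <- rem i ks].
have FP k : k \in rem i ks -> leaf_index n k \in s /\ 1 / 16 <= sqmod (a (leaf_index n k)).
  rewrite mem_rem_uniq // inE => /andP[ne_k /ksP[lt_k same]].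
  apply: (coef_large lt_i lt_k same us _ is_ _ ys_close); last by rewrite eq_sym.
  by move=> m /sJ[].
have le_F : \sum_(m <- F) sqmod (a m) <= \sum_(m <- s) sqmod (a m).
  apply: (ler_sum_subseq (g := fun m => sqmod (a m))) => //.
  - by move=> m; apply: sqmod_ge0.
  - by rewrite map_inj_uniq ?rem_uniq //; apply: leaf_index_inj.
  - by move=> m /mapP[k /FP[ks_ _] ->].
have ge_F : (D.-1)%:R / 16 <= \sum_(m <- F) sqmod (a m).
  rewrite big_map; apply: (@le_trans _ _ (\sum_(k <- rem i ks) (1 / 16 : R))).
    by rewrite big_const_seq count_predT size_rem // size_map size_iota iter_addr_0 -mulr_natl; lra.
  rewrite big_seq [leRHS]big_seq; apply: ler_sum => k /FP[]//.
have D_ge : 2 ^+ n <= (D.-1)%:R :> R.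
  rewrite -natrX ler_nat /D expnS; have : (0 < 2 ^ n)%N by rewrite expn_gt0.
  lia.
have P : (1 : R) <= 2 ^+ n by rewrite exprn_ege1 // ler1n.
have sum_ge : 2 ^+ n / 16 <= \sum_(m <- s) sqmod (a m).
  by apply: le_trans le_F; apply: le_trans ge_F; lra.
split=> //; first by apply: lt_le_trans sum_ge; lra.
have ys_le : sqnorm ys <= 4.
  have -> : ys = leaf n i - (leaf n i - ys) by rewrite opprB addrC subrK.
  have := sqnorm_sub S hip (leaf n i) (leaf n i - ys).
  have /andP[_ le1] := sqnorm_leaf lt_i; move: ys_close le1; lra.
apply: (le_trans ys_le); apply: (@le_trans _ _ (64 * (1 / 2) ^+ n * (2 ^+ n / 16))).
  have e : (1 / 2 : R) ^+ n * 2 ^+ n = 1.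
    by rewrite -exprMn div1r mulVf ?expr1n // pnatr_eq0.
  by rewrite mulrA -[64 * _ * _]mulrA e; lra.
by rewrite ler_wpM2l // mulr_ge0 // exprn_ge0 // divr_ge0.
Qed.

(** * No Riesz basis *)

Lemma geometric_small (C e : R) : 0 < e -> exists n : nat, C * (1 / 2) ^+ n < e.
Proof.
move=> e0; case: (lerP C 0) => [C0|C0].
  by exists 0%N; rewrite expr0 mulr1; apply: le_lt_trans e0.
have Ce : 0 <= C / e by rewrite divr_ge0 ?ltW.
exists (Num.bound (C / e)); set n := Num.bound _.
have : C / e < 2 ^+ n.
  by apply: lt_trans (archi_boundP Ce) _; rewrite -natrX ltr_nat ltn_expl.
by rewrite ltr_pdivrMr // mulrC expr_div_n expr1n div1r ltr_pdivrMr ?exprn_gt0 // [e * _]mulrC.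
Qed.

Lemma big_fset_seq (W : nmodType) (g : nat -> W) (s : seq nat) : uniq s ->
  \sum_(m <- [fset m in s]%fset) g m = \sum_(m <- s) g m.
Proof.
move=> us; apply: perm_big; apply: uniq_perm => // m.
by rewrite inE.
Qed.

(** The lower Riesz bound would give [1 <= M ^ 2 * 64 / 2 ^ n] for all [n]. *)
Lemma frame_vec_no_riesz (J : set nat) : ~ riesz_basis J frame_vec.
Proof.
move=> [clJ [M M0 hM]].
have Me := nneg_real S (ltW M0); set r := part1 S M in Me.
have r0 : 0 < r by rewrite -(of_real_gt0 S) -Me.
have [n hn] := geometric_small (r ^+ 2 * 64) ltr01.
have [s [a [us sJ pos le_s]]] := block_small_combination n clJ.
have AJ : [set` [fset m in s]%fset] `<=` J.
  by move=> m /=; rewrite inE => /sJ[].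
have := hM _ a AJ; rewrite !big_fset_seq // => /andP[low _].
have sumE : \sum_(m <- s) `|a m| ^+ 2 = of_real S (\sum_(m <- s) sqmod (a m)).
  by rewrite rmorph_sum; apply: eq_bigr => m _; rewrite (normr_sqmod S).
set sg := \sum_(m <- s) sqmod (a m) in pos le_s sumE.
rewrite sumE (@nnsqrtE _ _ (of_real S (Num.sqrt sg))) in low; last 2 first.
- by rewrite of_real_ge0 sqrtr_ge0.
- by rewrite -rmorphXn /= sqr_sqrtr // ltW.
have {}low : of_real S (Num.sqrt sg) <= of_real S r * `|\sum_(m <- s) a m *: frame_vec m|.
  by rewrite -Me -ler_pdivrMl.
have : of_real S (Num.sqrt sg) ^+ 2
    <= (of_real S r * `|\sum_(m <- s) a m *: frame_vec m|) ^+ 2.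
  by rewrite ler_pXn2r ?nnegrE ?of_real_ge0 ?sqrtr_ge0 // mulr_ge0 // of_real_ge0 ltW.
rewrite exprMn (normr_sqnorm S hip) -!rmorphXn /= -rmorphM ler_of_real sqr_sqrtr; last exact: ltW.
move=> le_sg.
have : sg < sg.
  apply: (le_lt_trans le_sg).
  apply: (@le_lt_trans _ _ (r ^+ 2 * (64 * (1 / 2) ^+ n * sg))).
    by rewrite ler_wpM2l // exprn_ge0 // ltW.
  by rewrite !mulrA -[ltRHS]mul1r ltr_pM2r.
by rewrite ltxx.
Qed.

(** * No unconditional basis *)

Section Subsequence.
Variable e : nat -> nat.
Hypothesis inj_e : injective e.
Hypothesis schauder_e : schauder_basis (frame_vec \o e).

Local Notation g := (frame_vec \o e).

Definition preindex m : nat := xget 0%N [set t | e t = m].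

Lemma preindexK t : preindex (e t) = t.
Proof. by apply: xget_unique => //= t' /inj_e. Qed.

Lemma dense_range : closure (linear_span (range e) frame_vec) = setT.
Proof.
rewrite eqEsubset; split=> // v _ B Bv; have [a [lim_a _]] := schauder_e v.
have [N _ /(_ N (leqnn N)) BN] := lim_a _ Bv.
exists (series (fun t => a t *: g t) N); split=> //.
exists [fset m in map e (iota 0 N)]%fset, (a \o preindex); split.
  by move=> m /=; rewrite inE => /mapP[t _ ->]; exists t.
rewrite (big_fset_seq (fun m => (a \o preindex) m *: frame_vec m)) ?map_inj_uniq ?iota_uniq //.
rewrite big_map /series /= /index_iota subn0; apply: eq_bigr => t _.
by rewrite preindexK.
Qed.

Lemma subsequence_small_combination n : exists (T : seq nat) (a : nat -> K),
  [/\ uniq T, forall t, t \in T -> block_of (e t) = n,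
      \sum_(t <- T) sqmod (a t) = 4 &
      sqnorm (\sum_(t <- T) a t *: g t) <= 256 * (1 / 2) ^+ n].
Proof.
have [s [a [us sJ pos le_s]]] := block_small_combination n dense_range.
set sg := \sum_(m <- s) _ in pos le_s.
have eK m : m \in s -> e (preindex m) = m.
  by move=> /sJ[[t _ <-] _]; rewrite preindexK.
pose c : R := Num.sqrt (4 / sg).
have c2 : sqmod (of_real S c) = 4 / sg by rewrite sqmod_real sqr_sqrtr // divr_ge0 // ltW.
exists (map preindex s), (fun t => of_real S c * a (e t)); split.
- by rewrite map_inj_in_uniq // => m p ms ps eq; rewrite -(eK m) // eq eK.
- by move=> t /mapP[m ms ->]; rewrite eK //; case: (sJ m ms).
- rewrite big_map big_seq.
  under eq_bigr => m ms do rewrite eK // sqmodM c2.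
  by rewrite -big_seq -mulr_sumr divfK // gt_eqF.
have -> : \sum_(t <- map preindex s) (of_real S c * a (e t)) *: g t
    = of_real S c *: \sum_(m <- s) a m *: frame_vec m.
  rewrite big_map scaler_sumr big_seq [RHS]big_seq; apply: eq_bigr => m ms.
  by rewrite /= eK // scalerA.
rewrite (sqnormZ S hip) c2.
apply: (@le_trans _ _ (4 / sg * (64 * (1 / 2) ^+ n * sg))).
  by rewrite ler_wpM2l // divr_ge0 // ltW.
rewrite [leLHS](_ : _ = 256 * (1 / 2) ^+ n) //.
by field; rewrite gt_eqF.
Qed.

Lemma injective_unbounded M : exists B, forall t, (B <= t)%N -> (M <= e t)%N.
Proof.
elim: M => [|M [B hB]]; first by exists 0%N.
case: (pselect (exists t, e t = M)) => [[t0 et0]|no].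
  exists (maxn B t0.+1) => t; rewrite geq_max => /andP[/hB le_M lt_t].
  rewrite ltn_neqAle le_M andbT; apply/eqP => eM.
  by have := lt_t; rewrite -(inj_e (etrans et0 eM)) ltnn.
exists B => t /hB le_M; rewrite ltn_neqAle le_M andbT; apply/eqP => eM.
by apply: no; exists t.
Qed.

(** Every block contains only finitely many frame vectors. *)
Lemma eventually_leaves_block n : exists B, forall t, (B <= t)%N -> block_of (e t) != n.
Proof.
have [B hB] := injective_unbounded (maxn (offset leaves n.+1) (offset means n.+1)).*2.
exists B => t /hB; rewrite /block_of => le_e.
have le_half : (maxn (offset leaves n.+1) (offset means n.+1) <= (e t)./2)%N.
  by rewrite geq_half_double.
have gt k : (forall p, 0 < k p)%N -> (offset k n.+1 <= (e t)./2)%N ->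
    (cell k (e t)./2).1 != n.
  by move=> k0 le_k; rewrite gtn_eqF // ltnNge -ltnS -(lt_offset k0) -leqNgt.
case: ifP => _; apply: gt (leq_trans _ le_half).
- exact: means_gt0.
- exact: leq_maxr.
- exact: leaves_gt0.
- exact: leq_maxl.
Qed.

(** The series is the expansion of the sum [x] of scaled small combinations, one
    for each block.  The part of this expansion in block [n] is a finite sum with
    the same coordinates as the small combination; their difference is an
    expansion of [0], so the coefficients agree. *)
Lemma convergent_series_large_on_blocks : exists (c : nat -> K) (T : nat -> seq nat),
  cvgn (series (fun t => c t *: g t)) /\ forall n,
    [/\ uniq (T n), forall t, t \in T n -> block_of (e t) = n &
                \sum_(t <- T n) sqmod (c t) = 4].
Proof.
have /choice[T /choice[al TP]] := subsequence_small_combination.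
pose y n := \sum_(t <- T n) al n t *: g t.
have y_in n : coords_in n (y n).
  have [_ Tn _ _] := TP n; rewrite /y big_seq.
  by apply: coords_in_sum => t /Tn <-; apply/coords_inZ/coords_in_frame.
pose U n := \sum_(p < n) y p.
have U_tail n d : sqnorm (U (n + d)%N - U n) <= 512 * ((1 / 2) ^+ n - (1 / 2) ^+ (n + d)).
  elim: d => [|d IH]; first by rewrite addn0 !subrr mulr0 (sqnorm0 S ip).
  have -> : U (n + d.+1)%N - U n = (U (n + d)%N - U n) + y (n + d)%N.
    by rewrite addnS /U big_ord_recr /= addrAC.
  have orth : ip (U (n + d)%N - U n) (y (n + d)%N) = 0.
    have U0 m : (m <= n + d)%N -> ip (U m) (y (n + d)%N) = 0.
      move=> le_m; rewrite ip_suml big1 // => p _.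
      apply: (coords_in_orth (n := p) (p := (n + d)%N)) => //.
      by rewrite ltn_eqF // (leq_trans (ltn_ord p)).
    by rewrite ipDl ipNl !U0 ?subrr ?leq_addr.
  rewrite (pythagoras S orth); have [_ _ _ le_y] := TP (n + d)%N.
  apply: le_trans (lerD IH le_y) _.
  rewrite addnS exprS; set q := (1 / 2) ^+ (n + d); set q' := (1 / 2) ^+ n; lra.
have /cvg_ex[x lim_U] : cvgn U.
  apply: (cvgn_sqnorm hip (S := S)) => r r0.
  have [N hN] := geometric_small 512 r0; exists N => n le_n.
  rewrite -(sqnormN S hip) opprB -(subnKC le_n).
  apply: le_lt_trans (U_tail _ _) _; apply: le_lt_trans hN.
  have : 0 <= (1 / 2 : R) ^+ (N + (n - N)) by rewrite exprn_ge0 // divr_ge0.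
  set q := _ ^+ (N + _); set q' := _ ^+ N; lra.
have ip_x n i : (i < leaves n)%N -> ip x (block_basis n i) = ip (y n) (block_basis n i).
  move=> lt_i; apply: (coord_lim lim_U); exists n.+1 => m lt_m.
  rewrite /U ip_suml (bigD1 (Ordinal lt_m)) //= big1 ?addr0 // => p.
  rewrite -val_eqE /= => ne_p; apply: y_in.
  by rewrite (cell_offset leaves_gt0 lt_i) /= eq_sym.
have [c [lim_c _]] := schauder_e x.
have cE n t : block_of (e t) = n -> c t = if t \in T n then al n t else 0.
  move=> bt; have [uT Tn _ _] := TP n.
  (* [w] and [z] are the coefficients in block [n] of the expansion of [x] and of
     [y n]. *)
  pose w t := if block_of (e t) == n then c t else 0.
  pose z t := if t \in T n then al n t else 0.
  have [B hB] := eventually_leaves_block n.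
  have sum_z N : (B <= N)%N -> \sum_(t < N) z t *: g t = y n.
    move=> le_N; rewrite /y.
    transitivity (\sum_(t <- iota 0 N | t \in T n) al n t *: g t).
      rewrite [RHS]big_mkcond -[X in iota _ X]subn0 -/(index_iota 0 N) big_mkord.
      by apply: eq_bigr => k _; rewrite /z; case: ifP => // _; rewrite scale0r.
    rewrite -big_filter; apply: perm_big; apply: uniq_perm => //.
      by rewrite filter_uniq ?iota_uniq.
    move=> k; rewrite mem_filter mem_iota /=; case: (boolP (k \in T n)) => //= kT.
    rewrite ltnNge; apply/negP => le_k.
    by have := hB k (leq_trans le_N le_k); rewrite Tn ?eqxx.
  have w_in N : coords_in n (\sum_(t < N) w t *: g t).
    apply: coords_in_sum => k _; rewrite /w; case: eqP => [<-|_].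
      by apply/coords_inZ/coords_in_frame.
    by rewrite scale0r => j _; rewrite ip0l.
  have ip_c N i : (i < leaves n)%N ->
      ip (series (fun t => c t *: g t) N) (block_basis n i)
      = ip (\sum_(t < N) w t *: g t) (block_basis n i).
    move=> lt_i; rewrite /series /= big_mkord !ip_suml; apply: eq_bigr => k _.
    rewrite !ipZl /w; case: eqP => // ne.
    rewrite mul0r coords_in_frame ?mulr0 // (cell_offset leaves_gt0 lt_i) /= eq_sym.
    exact/eqP.
  have w_const N : (B <= N)%N -> \sum_(t < N) w t *: g t = \sum_(t < B) w t *: g t.
    move=> le_N; rewrite -(subnKC le_N) big_split_ord /= [X in _ + X]big1 ?addr0 // => k _.
    by rewrite /w (negPf (hB _ (leq_addr _ _))) scale0r.
  have sum_w N : (B <= N)%N -> \sum_(t < N) w t *: g t = y n.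
    move=> le_N; rewrite w_const //; apply: (coords_in_eq (w_in B) (y_in n)) => i lt_i.
    rewrite -ip_x //; apply/esym/(coord_lim lim_c); exists B => m le_m.
    by rewrite ip_c // w_const.
  pose d t := w t - z t.
  have lim_d : series (fun t => d t *: g t) @ \oo --> (0 : H).
    apply: (iffLR (cvg_sqnorm S hip _ _)) => r r0; exists B => N le_N.
    rewrite /series /= big_mkord sub0r (sqnormN S hip).
    under eq_bigr do rewrite scalerBl.
    by rewrite sumrB sum_w // sum_z // subrr (sqnorm0 S ip).
  have lim_0 : series (fun t => (0 : K) *: g t) @ \oo --> (0 : H).
    apply: (iffLR (cvg_sqnorm S hip _ _)) => r r0; exists 0%N => N _.
    by rewrite /series /= big1 ?subr0 ?(sqnorm0 S ip) // => k _; rewrite scale0r.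
  have [d' [_ ud]] := schauder_e 0.
  have : d t = 0 by rewrite -(ud _ lim_d) (ud _ lim_0).
  by rewrite /d /w bt eqxx /z => /eqP; rewrite subr_eq0 => /eqP.
exists c, T; split; first by apply/cvg_ex; exists x.
move=> n; have [uT Tn sum4 _] := TP n; split=> //.
rewrite -sum4 big_seq [RHS]big_seq; apply: eq_bigr => t tT.
by rewrite (cE n) ?tT // Tn.
Qed.

(** In each block some of the terms have a sum of norm at least [1], and the
    blocks move to infinity along the subsequence. *)
Lemma not_unconditional : ~ unconditional_basis g.
Proof.
move=> [_ unc]; have [c [T [cv TP]]] := convergent_series_large_on_blocks.
have [|p [bij_p]] := divergent_rearrangement hip (u := fun t => c t *: g t) (S := S).
  move=> N; pose n := (\max_(t < N) block_of (e t)).+1.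
  have [uT Tn sum4] := TP n.
  have [F [uF FT le_F]] := @exists_large_subsum _ _ _ S _ _ hip _ (fun t => c t *: g t) uT.
  exists F; split=> // [t /FT tT|].
    rewrite leqNgt; apply/negP => lt_t.
    have := leq_bigmax (F := fun t : 'I_N => block_of (e t)) (Ordinal lt_t) => /=.
    by rewrite Tn // ltnn.
  suff e4 : \sum_(t <- T n) sqnorm (c t *: g t) = 4 by move: le_F; rewrite e4; lra.
  rewrite -sum4; apply: eq_bigr => t _.
  rewrite (sqnormZ S hip) -[sqnorm _]sqmod_norm norm_frame_vec.
  by rewrite -(rmorph1 (of_real S)) sqmod_real expr1n mulr1.
by apply; apply: unc.
Qed.

End Subsequence.

End Global.

Theorem proposition5p3 (R : realType) (K : numFieldType) (theta : K -> K)
  (hK : @hilbert_scalars R K theta)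
  (H : completeNormedModType K) (ip : {dot H for theta})
  (hip : norm_from_dot ip)
  (hsep : separable H) (hdim : ~ finite_dimensional H) :
  exists f : nat -> H,
    [/\ is_frame ip f,
        forall i : nat, `|f i| = 1,
        exists e : nat -> nat,
          {homo e : m n / (m < n)%N} /\ schauder_basis (f \o e),
        forall J : set nat, ~ riesz_basis J f
      & forall e : nat -> nat, injective e -> ~ unconditional_basis (f \o e)].
Proof.
have [S] := hilbert_scalars_parts hK.
have [b [ob cb]] := orthonormal_basis_exists S hip hsep hdim.
exists (frame_vec S b); split.
- exact: (frame_frame_vec S hip ob cb).
- exact: (norm_frame_vec S hip ob).
- exists double; split; first by move=> m n; rewrite ltn_double.
  exact: (schauder_frame_vec S hip ob cb).
- exact: (frame_vec_no_riesz hip ob cb).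
- move=> e inj_e unc; exact: (not_unconditional hip ob cb inj_e (Logic.proj1 unc) unc).
Qed.
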